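(* Assume $( * )$. There exist a Boolean algebra $\mathcal A$ with $\mathrm{fin}\subseteq\mathcal A\subseteq P(\omega)$ and a finitely additive probability measure $\mu$ on $\mathcal A$ such that (a) the quotient algebra $\mathcal A/\mathrm{fin}$ is not $\sigma$-centred, and (b) $\mu$ is almost strictly positive.
   Context: $\mathrm{fin}$ denotes the family of finite subsets of $\omega$. A finitely additive measure $\mu$ on an algebra $\mathcal A$ with $\mathrm{fin}\subseteq\mathcal A\subseteq P(\omega)$ is almost strictly positive if for every $A\in\mathcal A$: $\mu(A)=0$ iff $A$ is finite. Let $\lambda$ be the standard product measure on $2^\omega$, $\mathcal E$ the ideal of sets $A\subseteq 2^\omega$ with $\lambda(\overline A)=0$, $\kappa_0=\mathrm{cov}(\mathcal E)$ (least size of a cover of $2^\omega$ by members of $\mathcal E$), $\mathrm{cof}[\kappa_0]^{\le\omega}$ the least size of a family of countable subsets of $\kappa_0$ cofinal (under inclusion) among all countable subsets of $\kappa_0$, and $\mathfrak b$ the bounding number. The hypothesis $( * )$ is: $\mathrm{cof}[\kappa_0]^{\le\omega}\le\mathfrak b$. *)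

(* Defs.v *)
From Stdlib Require Import Reals List.
Open Scope R_scope.

(** Subsets of omega are predicates on nat; points of 2^omega are nat -> bool. *)

Definition finite_set (X : nat -> Prop) : Prop :=
  exists N : nat, forall k, X k -> (k < N)%nat.

Definition bool_alg_containing_fin (A : (nat -> Prop) -> Prop) : Prop :=
  (forall X, finite_set X -> A X) /\
  (forall X, A X -> A (fun k => ~ X k)) /\
  (forall X Y, A X -> A Y -> A (fun k => X k \/ Y k)).

Definition fa_prob_measure (A : (nat -> Prop) -> Prop) (mu : (nat -> Prop) -> R) : Prop :=
  mu (fun _ => True) = 1 /\
  (forall X, A X -> 0 <= mu X) /\
  (forall X Y, A X -> A Y -> (forall k, ~ (X k /\ Y k)) ->
     mu (fun k => X k \/ Y k) = mu X + mu Y).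

Definition almost_strictly_positive (A : (nat -> Prop) -> Prop) (mu : (nat -> Prop) -> R) : Prop :=
  forall X, A X -> (mu X = 0 <-> finite_set X).

(** The quotient A/fin: nonzero elements are (classes of) infinite X in A, and the
    meet of classes is the class of the intersection.  A family C of nonzero
    elements is centred iff every finite subfamily has nonzero meet. *)
Definition centred_mod_fin (A : (nat -> Prop) -> Prop) (C : (nat -> Prop) -> Prop) : Prop :=
  (forall X, C X -> A X /\ ~ finite_set X) /\
  (forall l : list (nat -> Prop), Forall C l ->
     ~ finite_set (fun k => Forall (fun X => X k) l)).

Definition quotient_sigma_centred (A : (nat -> Prop) -> Prop) : Prop :=
  exists c : nat -> ((nat -> Prop) -> Prop),
    (forall n, centred_mod_fin A (c n)) /\
    (forall X, A X -> ~ finite_set X -> exists n, c n X).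

Fixpoint in_cyl (s : list bool) (x : nat -> bool) (i : nat) : Prop :=
  match s with
  | nil => True
  | b :: s' => x i = b /\ in_cyl s' x (S i)
  end.

Fixpoint cyl_sum (f : nat -> list bool) (m : nat) : R :=
  match m with
  | O => 0
  | S m' => cyl_sum f m' + (/ 2) ^ length (f m')
  end.

(** lambda-null sets (Lebesgue outer measure zero for the product measure):
    for every n, covered by countably many cylinders of total measure <= 2^{-n}. *)
Definition lambda_null (C : (nat -> bool) -> Prop) : Prop :=
  forall n : nat, exists f : nat -> list bool,
    (forall m, cyl_sum f m <= (/ 2) ^ n) /\
    (forall x, C x -> exists i, in_cyl (f i) x 0).

Definition closure2 (A : (nat -> bool) -> Prop) (x : nat -> bool) : Prop :=
  forall n : nat, exists y, A y /\ forall i, (i < n)%nat -> y i = x i.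

Definition in_E (A : (nat -> bool) -> Prop) : Prop := lambda_null (closure2 A).

Definition E_cover (J : Type) (g : J -> ((nat -> bool) -> Prop)) : Prop :=
  (forall j, in_E (g j)) /\ (forall x, exists j, g j x).

(** K has cardinality cov(E): K indexes an E-cover and injects into every index set of an E-cover. *)
Definition is_cov_E (K : Type) : Prop :=
  (exists f : K -> ((nat -> bool) -> Prop), E_cover K f) /\
  (forall (J : Type) (g : J -> ((nat -> bool) -> Prop)), E_cover J g ->
     exists h : K -> J, forall a b, h a = h b -> a = b).

Definition countable_subset {K : Type} (S : K -> Prop) : Prop :=
  exists e : nat -> option K, forall x, S x -> exists n, e n = Some x.

Definition unbounded_family (B : Type) (h : B -> nat -> nat) : Prop :=
  ~ exists g : nat -> nat, forall b, exists N, forall n, (N <= n)%nat -> (h b n <= g n)%nat.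

(** Hypothesis ( * ): cof [cov(E)]^{<=omega} <= b, i.e. for K of size cov(E), every
    unbounded family (whose index set B has size >= b) admits a B-indexed family of
    countable subsets of K that is cofinal in [K]^{<=omega}. Since b is the least size
    of an unbounded family, this says exactly cof [K]^{<=omega} <= b. *)
Definition hyp_star : Prop :=
  exists K : Type, is_cov_E K /\
    forall (B : Type) (h : B -> nat -> nat), unbounded_family B h ->
      exists c : B -> (K -> Prop),
        (forall b, countable_subset (c b)) /\
        (forall S : K -> Prop, countable_subset S -> exists b, forall x, S x -> c b x).

(* Main.v *)
Require Import Defs.
From mathcomp Require boolp wochoice.
From Coquelicot Require Import Coquelicot.
From Stdlib Require Import Classical ClassicalEpsilon FunctionalExtensionality.
From Stdlib Require Import Reals Lra Lia Arith Cantor Wellfounded List.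
Open Scope R_scope.

(** Identify clopen subsets of the Cantor space with periodic subsets of [nat] through binary
    expansion.  To a decreasing sequence of clopen sets [C k], with intersection [K], attach a
    set [Z] of integers with [Z] almost included in every [C k].  The algebra is generated,
    modulo finite sets, by the clopen sets and one such [Z] for each countable set in a cofinal
    family of countable sets of indices of a cover by [E]-sets, [K] being disjoint from the
    corresponding null set.  A countable union of centred families would yield countably many
    points, all of which are missed by one of the sets [K]; hence the quotient is not
    sigma-centred.

    The measure of a Boolean combination of generators is the limit of the product measures of
    the clopen sets obtained by replacing every [Z] by [C k].  It is almost strictly positive
    provided that, for every earlier Boolean combination [t],
    - [t /\ K] is null only if some [t /\ C k] is already null, and
    - [t] meets [Z] (resp. its complement) in a finite set exactly when the measure of [t /\ K]
      (resp. [t /\ ~ K]) vanishes.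
    Each stage has fewer than [b] predecessors, so both can be achieved by letting [C k] shrink
    slowly and [Z] grow fast, as prescribed by a function dominating one requirement for each
    [t]. *)

(** * Well-orders and transfinite choice *)

(** Everything is read off least elements: of {x, y} for antisymmetry and totality, of {x, y, z} for
    transitivity, of the inaccessible points for well-foundedness. *)
Lemma well_ordering (T : Type) :
  exists lt : T -> T -> Prop,
    well_founded lt /\ (forall x y z, lt x y -> lt y z -> lt x z) /\
    (forall x y, lt x y \/ x = y \/ lt y x).
Proof.
  destruct (wochoice.well_ordering_principle (boolp.boolp_classicType__canonical__eqtype_Equality T))
    as [le wo].
  assert (min : forall P : T -> Prop, (exists x, P x) ->
            exists z, P z /\ forall x, P x -> le z x = true).
  { intros P [x Px].
    destruct (wo (fun y => boolp.asbool (P y))) as [z [[Pz lb] _]].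
    - exists x. apply boolp.asboolT. exact Px.
    - exists z. split.
      + apply (ssrbool.elimT (boolp.asboolP _)). exact Pz.
      + intros y Py. apply lb. apply boolp.asboolT. exact Py. }
  assert (anti : forall x y, le x y = true -> le y x = true -> x = y).
  { intros x y xy yx.
    destruct (wo (fun w => boolp.asbool (w = x \/ w = y))) as [z [_ uniq]].
    - exists x. apply boolp.asboolT. auto.
    - assert (refl : forall w, le w w = true).
      { intro w. destruct (min (fun v => v = w)) as [v [-> h]]; eauto. }
      transitivity z; [symmetry |]; apply uniq; split;
        try (apply boolp.asboolT; auto);
        intros w hw; apply (ssrbool.elimT (boolp.asboolP _)) in hw;
        destruct hw; subst; auto. }
  exists (fun x y => le x y = true /\ x <> y). split; [| split].
  - intro a. apply NNPP. intro na.
    destruct (min (fun x => ~ Acc (fun x y => le x y = true /\ x <> y) x)) as [z [nz lb]]; eauto.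
    apply nz. constructor. intros y [yz ne]. apply NNPP. intro ny.
    apply ne. apply anti; auto.
  - intros x y z [xy nxy] [yz nyz]. split; [| intros ->; apply nxy, anti; auto].
    destruct (min (fun w => w = x \/ w = y \/ w = z)) as [w [[-> | [-> | ->]] lb]]; eauto.
    + elim nxy. apply anti; auto.
    + elim nyz. apply anti; auto.
  - intros x y. destruct (classic (x = y)) as [| ne]; [tauto |].
    destruct (min (fun w => w = x \/ w = y)) as [w [[-> | ->] lb]]; eauto 6.
Qed.

(** The admissible values at [b] depend on the values at its predecessors, so [epsilon] is applied
    inside a well-founded recursion. This provides values below [b] only; [extend] fills the rest
    with [d0], which [Spec] cannot detect by the third hypothesis. *)
Lemma wf_dependent_choice (G D : Type) (lt : G -> G -> Prop) (d0 : D)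
    (Spec : G -> (G -> D) -> D -> Prop) :
  well_founded lt -> (forall x y z, lt x y -> lt y z -> lt x z) ->
  (forall b F F' d, (forall g, lt g b -> F g = F' g) -> Spec b F d -> Spec b F' d) ->
  (forall b F, (forall g, lt g b -> Spec g F (F g)) -> exists d, Spec b F d) ->
  exists F, forall b, Spec b F (F b).
Proof.
  intros wf trans ext ex.
  set (extend := fun (b : G) (rec : forall g, lt g b -> D) (g : G) =>
    match excluded_middle_informative (lt g b) with
    | left l => rec g l
    | right _ => d0
    end).
  set (step := fun (b : G) (rec : forall g, lt g b -> D) =>
    epsilon (inhabits d0) (Spec b (extend b rec))).
  set (F := Fix wf (fun _ => D) step).
  assert (FE : forall b, F b = step b (fun g _ => F g)).
  { intro b. unfold F. rewrite Fix_eq; [reflexivity |].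
    intros x f g fg. f_equal. extensionality y. extensionality p. apply fg. }
  assert (agree : forall b g, lt g b -> extend b (fun g _ => F g) g = F g).
  { intros b g l. unfold extend. destruct excluded_middle_informative; tauto. }
  exists F. intro b. induction b as [b IH] using (well_founded_ind wf).
  apply ext with (F := extend b (fun g _ => F g)); [apply agree |].
  rewrite FE. unfold step. apply epsilon_spec. apply ex.
  intros g l. rewrite agree by exact l.
  apply ext with (F := F); [| apply IH, l].
  intros g' l'. symmetry. apply agree. eapply trans; eauto.
Qed.

(** * Bounded families of functions *)

Definition eventually_le (h g : nat -> nat) : Prop :=
  exists N, forall n, (N <= n)%nat -> (h n <= g n)%nat.

(* Equivalently, the cardinality of [S] is smaller than the bounding number. *)
Definition small {T : Type} (S : T -> Prop) : Prop :=
  forall h : T -> nat -> nat, exists g, forall t, S t -> eventually_le (h t) g.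

Lemma small_image {T U : Type} (S : T -> Prop) (f : T -> U) :
  small S -> small (fun u => exists t, S t /\ u = f t).
Proof.
  intros sS h. destruct (sS (fun t => h (f t))) as [g Hg].
  exists g. intros u [t [St ->]]. apply Hg, St.
Qed.

Lemma small_subset {T : Type} (S S' : T -> Prop) :
  (forall t, S t -> S' t) -> small S' -> small S.
Proof. intros sub sS h. destruct (sS h) as [g Hg]. exists g. auto. Qed.

(** The diagonal of the running maxima eventually dominates each of countably many functions: the
    bounding number is uncountable. *)
Lemma small_nat (S : nat -> Prop) : small S.
Proof.
  intro h. set (m := fix m i n := match i with O => h O n | Datatypes.S j => Nat.max (m j n) (h i n) end).
  assert (mb : forall i j n, (j <= i)%nat -> (h j n <= m i n)%nat).
  { induction i as [| i IH]; intros j n l.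
    - replace j with O by lia. simpl. lia.
    - destruct (Nat.eq_dec j (Datatypes.S i)) as [-> | ne]; simpl; [lia |].
      specialize (IH j n). lia. }
  exists (fun n => m n n). intros t _. exists t. intros n l. apply mb, l.
Qed.

(** Dominate twice: [k t] bounds the requirements over [U] for a fixed [t], then [g] bounds all the
    [k t]. *)
Lemma small_prod {T U : Type} (S : T -> Prop) (S' : U -> Prop) :
  small S -> small S' -> small (fun p : T * U => S (fst p) /\ S' (snd p)).
Proof.
  intros sS sS' h.
  destruct (choice (fun t g => forall u, S' u -> eventually_le (h (t, u)) g)) as [k Hk].
  { intro t. apply (sS' (fun u => h (t, u))). }
  destruct (sS k) as [g Hg]. exists g. intros [t u] [St S'u].
  destruct (Hk t u S'u) as [N HN], (Hg t St) as [M HM].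
  exists (Nat.max N M). intros n l. specialize (HN n). specialize (HM n). lia.
Qed.

Lemma small_union_nat {T : Type} (S : nat -> T -> Prop) :
  (forall i, small (S i)) -> small (fun t => exists i, S i t).
Proof.
  intros sS h.
  destruct (choice (fun i g => forall t, S i t -> eventually_le (h t) g)) as [k Hk].
  { intro i. apply sS. }
  destruct (small_nat (fun _ => True) k) as [g Hg]. exists g. intros t [i Si].
  destruct (Hk i t Si) as [N HN], (Hg i I) as [M HM].
  exists (Nat.max N M). intros n l. specialize (HN n). specialize (HM n). lia.
Qed.

Lemma small_union {T : Type} (S S' : T -> Prop) :
  small S -> small S' -> small (fun t => S t \/ S' t).
Proof.
  intros sS sS'.
  apply small_subset with (S' := fun t => exists i : nat, match i with O => S t | _ => S' t end).
  - intros t [St | S't]; [exists 0%nat | exists 1%nat]; assumption.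
  - apply small_union_nat. intros [| i]; assumption.
Qed.

(** Reconciles two demands on the index set: it carries an unbounded family, so that [hyp_star]
    applies, and yet every initial segment is small, so that the requirements of all predecessors
    can be dominated. If some initial segment of a well-order of Baire space is not small, the least
    such segment is taken, otherwise the whole space. *)
Lemma small_index_order :
  exists (B : Type) (lt : B -> B -> Prop) (h : B -> nat -> nat),
    well_founded lt /\ (forall x y z, lt x y -> lt y z -> lt x z) /\
    (forall x y, lt x y \/ x = y \/ lt y x) /\
    unbounded_family B h /\ forall b, small (fun g => lt g b).
Proof.
  destruct (well_ordering (nat -> nat)) as (lt & wf & trans & tot).
  destruct (classic (forall b, small (fun g => lt g b))) as [all | nall].
  - exists (nat -> nat), lt, (fun f => f). do 3 (split; [assumption |]). split; [| exact all].
    intros [g Hg]. destruct (Hg (fun n => S (g n))) as [N HN].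
    specialize (HN N (le_n N)). lia.
  - apply not_all_ex_not in nall. destruct nall as [a0 na0].
    assert (least : exists a, ~ small (fun g => lt g a) /\
                      forall b, lt b a -> small (fun g => lt g b)).
    { induction a0 as [a IH] using (well_founded_ind wf).
      destruct (classic (forall b, lt b a -> small (fun g => lt g b))) as [y | n]; [eauto |].
      apply not_all_ex_not in n. destruct n as [b n]. apply imply_to_and in n.
      destruct n. eauto. }
    destruct least as (a & na & lea).
    apply not_all_ex_not in na. destruct na as [h Hh].
    exists {g | lt g a}, (fun x y => lt (proj1_sig x) (proj1_sig y)), (fun x => h (proj1_sig x)).
    split; [| split; [| split; [| split]]].
    + apply wf_inverse_image, wf.
    + intros x y z. apply trans.
    + intros [x p] [y q]. simpl. destruct (tot x y) as [| [-> |]]; auto.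
      right. left. f_equal. apply proof_irrelevance.
    + intros [g Hg]. apply Hh. exists g. intros t l. exact (Hg (exist _ t l)).
    + intros [b p] k. simpl.
      (* Requirements given on the segment are extended by zero, since smallness below [b] concerns
         the ambient type. *)
      destruct (lea b p (fun g => match excluded_middle_informative (lt g a) with
                                  | left l => k (exist _ g l)
                                  | right _ => fun _ => O end)) as [g Hg].
      exists g. intros [x q] l. specialize (Hg x l).
      destruct excluded_middle_informative as [q' |]; [| tauto].
      replace q with q' by apply proof_irrelevance. exact Hg.
Qed.

(** * The product measure on clopen subsets of the Cantor space *)

Definition dep (k : nat) (P : (nat -> bool) -> Prop) : Prop :=
  forall x y, (forall i, (i < k)%nat -> x i = y i) -> P x -> P y.

Definition clopen (P : (nat -> bool) -> Prop) : Prop := exists k, dep k P.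

Definition scons (b : bool) (x : nat -> bool) : nat -> bool :=
  fun i => match i with O => b | S j => x j end.

Definition indicator (P : Prop) : R := if excluded_middle_informative P then 1 else 0.

(** The proportion of words of length [j], continued by zeros, that lie in [P]. *)
Fixpoint avg (j : nat) (P : (nat -> bool) -> Prop) : R :=
  match j with
  | O => indicator (P (fun _ => false))
  | S i => (avg i (fun x => P (scons false x)) + avg i (fun x => P (scons true x))) / 2
  end.

(** For a clopen set [avg j] is constant once [j] reaches the level of dependence, so the limit is
    its product measure. *)
Definition lam (P : (nat -> bool) -> Prop) : R := real (Lim_seq (fun j => avg j P)).

Lemma scons_shift (x : nat -> bool) : scons (x O) (fun i => x (S i)) = x.
Proof. extensionality i. destruct i; reflexivity. Qed.

Lemma dep_scons k P b : dep (S k) P -> dep k (fun x => P (scons b x)).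
Proof.
  intros d x y e. apply d. intros [| i] l; simpl; [reflexivity | apply e; lia].
Qed.

Lemma dep_le k j P : dep k P -> (k <= j)%nat -> dep j P.
Proof. intros d l x y e. apply d. intros i li. apply e. lia. Qed.

Lemma dep_and k P Q : dep k P -> dep k Q -> dep k (fun x => P x /\ Q x).
Proof. intros dP dQ x y e [p q]. split; [apply (dP x) | apply (dQ x)]; auto. Qed.

Lemma dep_not k P : dep k P -> dep k (fun x => ~ P x).
Proof. intros dP x y e n p. apply n, (dP y); auto. intros i l. symmetry. auto. Qed.

Lemma clopen_const (P : Prop) : clopen (fun _ => P).
Proof. exists O. intros x y _ p. exact p. Qed.

Lemma clopen_bit i : clopen (fun x => x i = true).
Proof. exists (S i). intros x y e p. rewrite <- e; [exact p | lia]. Qed.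

Lemma clopen_and P Q : clopen P -> clopen Q -> clopen (fun x => P x /\ Q x).
Proof.
  intros [k dP] [j dQ]. exists (Nat.max k j).
  apply dep_and; eapply dep_le; eauto; lia.
Qed.

Lemma clopen_not P : clopen P -> clopen (fun x => ~ P x).
Proof. intros [k dP]. exists k. apply dep_not, dP. Qed.

Lemma clopen_ext P Q : (forall x, P x <-> Q x) -> clopen P -> clopen Q.
Proof. intros e [k d]. exists k. intros x y a q. apply e, (d x), e, q. exact a. Qed.

Lemma clopen_or P Q : clopen P -> clopen Q -> clopen (fun x => P x \/ Q x).
Proof.
  intros cP cQ. apply clopen_ext with (P := fun x => ~ (~ P x /\ ~ Q x)).
  - intro x. tauto.
  - apply clopen_not, clopen_and; apply clopen_not; assumption.
Qed.

Lemma avg_mono j : forall P Q, (forall x, P x -> Q x) -> avg j P <= avg j Q.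
Proof.
  induction j as [| j IH]; intros P Q PQ; simpl.
  - specialize (PQ (fun _ => false)). unfold indicator.
    do 2 destruct excluded_middle_informative; try lra; tauto.
  - assert (h := IH (fun x => P (scons false x)) (fun x => Q (scons false x))).
    assert (h' := IH (fun x => P (scons true x)) (fun x => Q (scons true x))).
    specialize (h (fun x => PQ _)). specialize (h' (fun x => PQ _)). lra.
Qed.

Lemma avg_full j : avg j (fun _ => True) = 1.
Proof.
  induction j as [| j IH]; simpl.
  - unfold indicator. destruct excluded_middle_informative; tauto.
  - rewrite IH. lra.
Qed.

Lemma avg_or_and j : forall P Q,
  avg j (fun x => P x \/ Q x) + avg j (fun x => P x /\ Q x) = avg j P + avg j Q.
Proof.
  induction j as [| j IH]; intros P Q; simpl.
  - unfold indicator. repeat destruct excluded_middle_informative; try lra; tauto.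
  - assert (h := IH (fun x => P (scons false x)) (fun x => Q (scons false x))).
    assert (h' := IH (fun x => P (scons true x)) (fun x => Q (scons true x))).
    simpl in h, h'. lra.
Qed.

Lemma avg_empty j P : (forall x, ~ P x) -> avg j P = 0.
Proof.
  intro n. revert P n. induction j as [| j IH]; intros P n; simpl.
  - unfold indicator. destruct excluded_middle_informative; [elim (n _ p) | reflexivity].
  - rewrite !IH; [lra | |]; intro x; apply n.
Qed.

Lemma avg_ge0 j P : 0 <= avg j P.
Proof.
  rewrite <- (avg_empty j (fun _ => False)) by tauto. apply avg_mono. tauto.
Qed.

Lemma avg_ext j P Q : (forall x, P x <-> Q x) -> avg j P = avg j Q.
Proof. intro e. apply Rle_antisym; apply avg_mono; firstorder. Qed.

Lemma avg_dep k : forall j P, dep k P -> (k <= j)%nat -> avg j P = avg k P.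
Proof.
  induction k as [| k IH].
  - intro j. induction j as [| j IHj]; intros P d l; [reflexivity |]. simpl.
    assert (c : forall x y, P x <-> P y).
    { intros x y. split; apply d; intros i li; lia. }
    rewrite (avg_ext j (fun x => P (scons false x)) P), (avg_ext j (fun x => P (scons true x)) P),
      IHj by (auto || lia).
    simpl. lra.
  - intros [| j] P d l; [lia |]. simpl.
    rewrite !(IH j) by (lia || apply dep_scons, d). reflexivity.
Qed.

Lemma avg_eq0 k : forall P, dep k P -> avg k P = 0 -> forall x, ~ P x.
Proof.
  induction k as [| k IH]; intros P d z x p.
  - simpl in z. unfold indicator in z. destruct excluded_middle_informative; [lra |].
    apply n, (d x); [intros i l; lia | exact p].
  - simpl in z.
    assert (h := avg_ge0 k (fun x => P (scons false x))).
    assert (h' := avg_ge0 k (fun x => P (scons true x))).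
    rewrite <- (scons_shift x) in p.
    destruct (x O);
    [ apply (IH (fun x => P (scons true x))) with (x := fun i => x (S i))
    | apply (IH (fun x => P (scons false x))) with (x := fun i => x (S i))];
      try (apply dep_scons, d); try exact p; lra.
Qed.

Lemma avg_in_cyl s : forall j, (length s <= j)%nat ->
  avg j (fun x => in_cyl s x 0) <= (/ 2) ^ length s.
Proof.
  assert (sh : forall s x b i, in_cyl s (scons b x) (S i) <-> in_cyl s x i).
  { induction s0 as [| c s0 IHs]; intros x b i; simpl; [tauto |]. rewrite IHs. tauto. }
  induction s as [| c s IH]; intros j l.
  - simpl. rewrite avg_full. lra.
  - destruct j as [| j]; simpl in l; [lia |]. simpl.
    assert (e : forall b, avg j (fun x => b = c /\ in_cyl s (scons b x) 1)
                <= if Bool.bool_dec b c then (/ 2) ^ length s else 0).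
    { intro b. destruct Bool.bool_dec as [-> | ne].
      - eapply Rle_trans; [| apply (IH j); lia]. apply avg_mono. intro x. rewrite sh. tauto.
      - rewrite avg_empty; [lra |]. tauto. }
    assert (h := e false). assert (h' := e true).
    simpl in h, h'. destruct c; simpl in h, h'; lra.
Qed.

Lemma lam_dep k P : dep k P -> lam P = avg k P.
Proof.
  intro d. unfold lam.
  rewrite (Lim_seq_ext_loc _ (fun _ => avg k P)); [rewrite Lim_seq_const; reflexivity |].
  exists k. intros n l. apply avg_dep; auto.
Qed.

Lemma lam_common P Q : clopen P -> clopen Q ->
  exists k, (forall j, (k <= j)%nat -> lam P = avg j P) /\ (forall j, (k <= j)%nat -> lam Q = avg j Q).
Proof.
  intros [k dP] [k' dQ]. exists (Nat.max k k').
  split; intros j l; apply lam_dep; eapply dep_le; eauto; lia.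
Qed.

Lemma lam_mono P Q : clopen P -> clopen Q -> (forall x, P x -> Q x) -> lam P <= lam Q.
Proof.
  intros cP cQ PQ. destruct (lam_common P Q cP cQ) as (k & hP & hQ).
  rewrite (hP k), (hQ k) by lia. apply avg_mono, PQ.
Qed.

Lemma lam_ge0 P : clopen P -> 0 <= lam P.
Proof. intros [k d]. rewrite (lam_dep k) by exact d. apply avg_ge0. Qed.

Lemma lam_full : lam (fun _ => True) = 1.
Proof.
  rewrite (lam_dep 0); [apply avg_full | intros x y _ p; exact p].
Qed.

Lemma lam_or_and P Q : clopen P -> clopen Q ->
  lam (fun x => P x \/ Q x) + lam (fun x => P x /\ Q x) = lam P + lam Q.
Proof.
  intros cP cQ. destruct (lam_common P Q cP cQ) as (k & hP & hQ).
  destruct (lam_common (fun x => P x \/ Q x) (fun x => P x /\ Q x)) as (k' & h & h');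
    [apply clopen_or; auto | apply clopen_and; auto |].
  set (m := Nat.max k k').
  rewrite (hP m), (hQ m), (h m), (h' m) by lia. apply avg_or_and.
Qed.

Lemma lam_or_le P Q : clopen P -> clopen Q -> lam (fun x => P x \/ Q x) <= lam P + lam Q.
Proof.
  intros cP cQ. rewrite <- lam_or_and by assumption.
  assert (h := lam_ge0 _ (clopen_and _ _ cP cQ)). lra.
Qed.

Lemma lam_eq0 P : clopen P -> lam P = 0 -> forall x, ~ P x.
Proof. intros [k d] z. rewrite (lam_dep k) in z by exact d. apply (avg_eq0 k); auto. Qed.

Lemma lam_ext P Q : (forall x, P x <-> Q x) -> lam P = lam Q.
Proof.
  intro e. unfold lam. f_equal. apply Lim_seq_ext. intro n. apply avg_ext, e.
Qed.

Lemma lam_split P Q : clopen P -> clopen Q ->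
  lam (fun x => P x /\ Q x) + lam (fun x => P x /\ ~ Q x) = lam P.
Proof.
  intros cP cQ. rewrite <- lam_or_and by auto using clopen_and, clopen_not.
  rewrite (lam_ext (fun x => _ \/ _) P) by (intro x; tauto).
  rewrite (lam_ext (fun x => _ /\ _) (fun _ => False)) by (intro x; tauto).
  rewrite (lam_dep 0 (fun _ => False)) by (intros x y _ p; exact p).
  rewrite avg_empty by tauto. lra.
Qed.

(** * Limits of measures along Cauchy sequences of clopen sets *)

(** Cauchy for the measure of the symmetric difference: as [k] and [l] range over the same tail,
    one-sided differences suffice. Such a sequence stands for an element of the measure algebra. *)
Definition cauchy_clopen (p : nat -> (nat -> bool) -> Prop) : Prop :=
  (forall k, clopen (p k)) /\
  forall eps, 0 < eps -> exists N, forall k l, (N <= k)%nat -> (N <= l)%nat ->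
    lam (fun x => p k x /\ ~ p l x) <= eps.

Definition lim_lam (p : nat -> (nat -> bool) -> Prop) : R := real (Lim_seq (fun k => lam (p k))).

Definition decreasing_sets (C : nat -> (nat -> bool) -> Prop) : Prop :=
  forall k l x, (k <= l)%nat -> C l x -> C k x.

Lemma lim_lam_correct p : cauchy_clopen p -> is_lim_seq (fun k => lam (p k)) (lim_lam p).
Proof.
  intros [cl ca]. apply Lim_seq_correct'. apply ex_lim_seq_cauchy_corr.
  intros [eps pos]. destruct (ca (eps / 2)) as [N HN]; [lra |].
  exists N. simpl. intros n m ln lm.
  assert (h : forall n m, (N <= n)%nat -> (N <= m)%nat -> lam (p n) <= lam (p m) + eps / 2).
  { clear n m ln lm. intros n m ln lm. rewrite <- (lam_split (p n) (p m)) by apply cl.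
    apply Rplus_le_compat; [| apply HN; auto].
    apply lam_mono; auto using clopen_and. tauto. }
  assert (h1 := h n m ln lm). assert (h2 := h m n lm ln).
  apply Rabs_def1; lra.
Qed.

Lemma cauchy_const P : clopen P -> cauchy_clopen (fun _ => P).
Proof.
  intro c. split; [auto |]. intros eps pos. exists O. intros k l _ _.
  rewrite (lam_ext _ (fun _ => False)) by (intro x; tauto).
  rewrite (lam_dep 0), avg_empty; [lra | tauto | intros x y _ p; exact p].
Qed.

Lemma cauchy_not p : cauchy_clopen p -> cauchy_clopen (fun k x => ~ p k x).
Proof.
  intros [cl ca]. split; [intro k; apply clopen_not, cl |].
  intros eps pos. destruct (ca eps pos) as [N HN]. exists N. intros k l lk ll.
  rewrite (lam_ext _ (fun x => p l x /\ ~ p k x)) by (intro x; tauto). auto.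
Qed.

Lemma cauchy_and p q : cauchy_clopen p -> cauchy_clopen q ->
  cauchy_clopen (fun k x => p k x /\ q k x).
Proof.
  intros [cl ca] [cl' ca']. split; [intro k; apply clopen_and; auto |].
  intros eps pos. destruct (ca (eps / 2)) as [N HN]; [lra |].
  destruct (ca' (eps / 2)) as [N' HN']; [lra |].
  exists (Nat.max N N'). intros k l lk ll.
  apply Rle_trans with (lam (fun x => (p k x /\ ~ p l x) \/ (q k x /\ ~ q l x))).
  - apply lam_mono; [| | intro x; tauto];
    repeat (apply clopen_or || apply clopen_and || apply clopen_not); auto.
  - eapply Rle_trans; [apply lam_or_le; apply clopen_and; auto; apply clopen_not; auto |].
    specialize (HN k l). specialize (HN' k l).
    assert (lam (fun x => p k x /\ ~ p l x) <= eps / 2) by (apply HN; lia).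
    assert (lam (fun x => q k x /\ ~ q l x) <= eps / 2) by (apply HN'; lia). lra.
Qed.

(** The measures decrease and are bounded below, hence converge; for nested sets the measure of the
    difference is the difference of the measures. *)
Lemma decreasing_tail C : (forall k, clopen (C k)) -> decreasing_sets C ->
  forall eps, 0 < eps -> exists N, forall l, (N <= l)%nat -> lam (fun x => C N x /\ ~ C l x) <= eps.
Proof.
  intros cl de eps pos.
  assert (dl : forall k l, (k <= l)%nat -> lam (C l) <= lam (C k)).
  { intros k l kl. apply lam_mono; auto. intro x. apply de, kl. }
  assert (ex : ex_finite_lim_seq (fun k => lam (C k))).
  { apply ex_finite_lim_seq_decr with 0; intro n; [apply dl; lia | apply lam_ge0, cl]. }
  apply ex_lim_seq_cauchy_corr in ex.
  destruct (ex (mkposreal eps pos)) as [N HN]. simpl in HN. exists N. intros l Nl.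
  specialize (HN N l (le_n N) Nl). apply Rabs_def2 in HN.
  assert (h := lam_split (C N) (C l) (cl N) (cl l)).
  rewrite (lam_ext (fun x => C N x /\ C l x) (C l)) in h; [lra |].
  intro x. split; [tauto |]. intro c. split; [apply (de N l x Nl c) | exact c].
Qed.

Lemma cauchy_decreasing C : (forall k, clopen (C k)) -> decreasing_sets C -> cauchy_clopen C.
Proof.
  intros cl de. split; [exact cl |]. intros eps pos.
  destruct (decreasing_tail C cl de eps pos) as [N HN]. exists N. intros k l lk ll.
  eapply Rle_trans; [| apply (HN l ll)].
  apply lam_mono; auto using clopen_and, clopen_not.
  intros x [c n]. split; [apply (de N k x lk c) | exact n].
Qed.

Lemma lim_lam_le p q delta : cauchy_clopen p -> cauchy_clopen q ->
  (exists N, forall m, (N <= m)%nat -> lam (p m) <= lam (q m) + delta) ->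
  lim_lam p <= lim_lam q + delta.
Proof.
  intros cp cq [N HN].
  apply (is_lim_seq_le_loc (fun k => lam (p k)) (fun k => lam (q k) + delta)
           (lim_lam p) (lim_lam q + delta)).
  - exists N. exact HN.
  - apply lim_lam_correct, cp.
  - apply is_lim_seq_plus'; [apply lim_lam_correct, cq | apply is_lim_seq_const].
Qed.

Lemma lim_lam_mono p q : cauchy_clopen p -> cauchy_clopen q ->
  (exists N, forall m x, (N <= m)%nat -> p m x -> q m x) -> lim_lam p <= lim_lam q.
Proof.
  intros cp cq [N HN]. rewrite <- (Rplus_0_r (lim_lam q)). apply lim_lam_le; auto.
  exists N. intros m l. rewrite Rplus_0_r. apply lam_mono; [apply cp | apply cq |].
  intros x. apply HN, l.
Qed.

Lemma lim_lam_ext p q : (forall k x, p k x <-> q k x) -> lim_lam p = lim_lam q.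
Proof.
  intro e. unfold lim_lam. f_equal. apply Lim_seq_ext. intro k. apply lam_ext, e.
Qed.

Lemma lim_lam_const P : lim_lam (fun _ => P) = lam P.
Proof. unfold lim_lam. rewrite Lim_seq_const. reflexivity. Qed.

Lemma lim_lam_ge0 p : cauchy_clopen p -> 0 <= lim_lam p.
Proof.
  intro c. apply (is_lim_seq_le (fun _ => 0) (fun k => lam (p k)) 0 (lim_lam p)).
  - intro n. apply lam_ge0, c.
  - apply is_lim_seq_const.
  - apply lim_lam_correct, c.
Qed.

Lemma lim_lam_split p q : cauchy_clopen p -> cauchy_clopen q ->
  lim_lam (fun k x => p k x /\ q k x) + lim_lam (fun k x => p k x /\ ~ q k x) = lim_lam p.
Proof.
  intros cp cq.
  assert (h := is_lim_seq_plus' _ _ _ _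
    (lim_lam_correct _ (cauchy_and _ _ cp cq))
    (lim_lam_correct _ (cauchy_and _ _ cp (cauchy_not _ cq)))).
  apply is_lim_seq_ext with (v := fun k => lam (p k)) in h.
  - apply is_lim_seq_unique in h. unfold lim_lam at 3. rewrite h. reflexivity.
  - intro k. apply lam_split; [apply cp | apply cq].
Qed.

Lemma lim_lam_or p q : cauchy_clopen p -> cauchy_clopen q ->
  lim_lam (fun k x => p k x \/ q k x) + lim_lam (fun k x => p k x /\ q k x)
  = lim_lam p + lim_lam q.
Proof.
  intros cp cq.
  rewrite <- (lim_lam_split q p) by assumption.
  rewrite <- (lim_lam_split (fun k x => p k x \/ q k x) p).
  - rewrite (lim_lam_ext (fun k x => (p k x \/ q k x) /\ p k x) p) by (intros; tauto).
    rewrite (lim_lam_ext (fun k x => (p k x \/ q k x) /\ ~ p k x) (fun k x => q k x /\ ~ p k x))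
      by (intros; tauto).
    rewrite (lim_lam_ext (fun k x => p k x /\ q k x) (fun k x => q k x /\ p k x)) by (intros; tauto).
    lra.
  - assert (c := cauchy_not _ (cauchy_and _ _ (cauchy_not _ cp) (cauchy_not _ cq))).
    replace (fun k x => p k x \/ q k x) with (fun k x => ~ (~ p k x /\ ~ q k x)); [exact c |].
    extensionality k. extensionality x. apply boolp.propext. tauto.
  - exact cp.
Qed.

(** * Meets with a decreasing sequence of clopen sets and with its complements *)

Section DecreasingIntersection.

Variables (p C : nat -> (nat -> bool) -> Prop).
Hypotheses (cp : cauchy_clopen p) (clC : forall k, clopen (C k)) (deC : decreasing_sets C).

Let cC : cauchy_clopen C := cauchy_decreasing C clC deC.
Let cCk k : cauchy_clopen (fun _ => C k) := cauchy_const (C k) (clC k).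

Lemma lim_lam_meet_le k :
  lim_lam (fun m x => p m x /\ C m x) <= lim_lam (fun m x => p m x /\ C k x).
Proof.
  apply lim_lam_mono; try (apply cauchy_and; auto).
  exists k. intros m x l [a b]. split; [exact a | exact (deC k m x l b)].
Qed.

(** Continuity from above: for [k] far enough, passing from [C k] to a later [C m] loses at most
    [d], whatever [p] is. *)
Lemma lim_lam_meet_ge eps : (forall k, eps <= lim_lam (fun m x => p m x /\ C k x)) ->
  eps <= lim_lam (fun m x => p m x /\ C m x).
Proof.
  intro h. apply le_epsilon. intros d pos.
  destruct (decreasing_tail C clC deC d pos) as [k Hk].
  eapply Rle_trans; [apply (h k) |].
  apply lim_lam_le; try (apply cauchy_and; auto).
  exists k. intros m l. specialize (Hk m l).
  rewrite <- (lam_split (fun x => p m x /\ C k x) (C m)) by (auto; apply clopen_and; auto; apply cp).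
  apply Rplus_le_compat.
  - apply lam_mono; repeat (apply clopen_and); auto; try apply cp. tauto.
  - eapply Rle_trans; [| exact Hk].
    apply lam_mono; repeat (apply clopen_and || apply clopen_not); auto; try apply cp. tauto.
Qed.

Lemma lim_lam_diff_eq0 :
  lim_lam (fun m x => p m x /\ ~ C m x) = 0 <->
  forall k, lim_lam (fun m x => p m x /\ ~ C k x) = 0.
Proof.
  split.
  - intros z k. apply Rle_antisym; [| apply lim_lam_ge0, cauchy_and; auto; apply cauchy_not, cCk].
    rewrite <- z. apply lim_lam_mono; try (apply cauchy_and; auto; apply cauchy_not; auto).
    exists k. intros m x l [a b]. split; [exact a |]. intro c. exact (b (deC k m x l c)).
  - intro z. apply Rle_antisym; [| apply lim_lam_ge0, cauchy_and; auto; apply cauchy_not, cC].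
    apply le_epsilon. intros d pos.
    destruct (decreasing_tail C clC deC d pos) as [k Hk].
    rewrite <- (z k). apply lim_lam_le; try (apply cauchy_and; auto; apply cauchy_not; auto).
    exists k. intros m l. specialize (Hk m l).
    rewrite <- (lam_split (fun x => p m x /\ ~ C m x) (fun x => ~ C k x))
      by (try apply clopen_and; auto using clopen_not; apply cp).
    apply Rplus_le_compat.
    + apply lam_mono; repeat (apply clopen_and || apply clopen_not); auto; try apply cp. tauto.
    + eapply Rle_trans; [| exact Hk].
      apply lam_mono; repeat (apply clopen_and || apply clopen_not); auto; try apply cp.
      intro x. tauto.
Qed.

End DecreasingIntersection.

(** * Neighbourhoods of closed null sets *)

(** The union of the cylinders of length [j] that meet [A]; over all [j] these intersect in
    [closure2 A]. *)
Definition nbhd (A : (nat -> bool) -> Prop) (j : nat) (x : nat -> bool) : Prop :=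
  exists y, A y /\ forall i, (i < j)%nat -> y i = x i.

Lemma nbhd_dep A j : dep j (nbhd A j).
Proof.
  intros x y e [z [a b]]. exists z. split; [exact a |]. intros i l. rewrite <- e by exact l. auto.
Qed.

Lemma nbhd_anti A j k x : (j <= k)%nat -> nbhd A k x -> nbhd A j x.
Proof. intros l [y [a b]]. exists y. split; [exact a |]. intros i li. apply b. lia. Qed.

Lemma in_cyl_agree s : forall x y i,
  (forall m, (m < i + length s)%nat -> x m = y m) -> in_cyl s x i -> in_cyl s y i.
Proof.
  induction s as [| b s IH]; intros x y i e; simpl in *; [tauto |].
  intros [h t]. split; [rewrite <- e by lia; exact h |].
  apply (IH x); [| exact t]. intros m l. apply e. lia.
Qed.

(* König's lemma: [bad n x] is read as a property of the first [n] coordinates of [x]. *)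
Lemma bad_branch (bad : nat -> (nat -> bool) -> Prop) :
  (forall n x y, (forall i, (i < n)%nat -> x i = y i) -> bad n x -> bad n y) ->
  (forall x, bad O x) ->
  (forall n x, bad n x -> exists y, (forall i, (i < n)%nat -> y i = x i) /\ bad (S n) y) ->
  exists x, forall n, bad n x.
Proof.
  intros ext b0 step.
  destruct (choice (fun (p : nat * (nat -> bool)) y => bad (fst p) (snd p) ->
     (forall i, (i < fst p)%nat -> y i = snd p i) /\ bad (S (fst p)) y)) as [next Hnext].
  { intros [n x]. simpl. destruct (classic (bad n x)) as [b | nb].
    - destruct (step n x b) as [y hy]. exists y. auto.
    - exists x. tauto. }
  set (z := fix z n := match n with O => fun _ : nat => false | S m => next (m, z m) end).
  assert (bz : forall n, bad n (z n)).
  { induction n as [| n IH]; [apply b0 |]. apply (Hnext (n, z n)), IH. }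
  assert (az : forall n m i, (i < n)%nat -> (n <= m)%nat -> z m i = z n i).
  { intros n m i li l. induction m as [| m IH]; [f_equal; lia |].
    destruct (Nat.eq_dec n (S m)) as [-> | ne]; [reflexivity |].
    rewrite <- IH by lia. apply (Hnext (m, z m)); [apply bz | simpl; lia]. }
  (* Coordinate [i] no longer changes from stage [S i] on. *)
  exists (fun i => z (S i) i). intro n. apply (ext n (z n)); [| apply bz].
  intros i l. apply az; lia.
Qed.

(** Compactness: by König's lemma finitely many cylinders of a cover of the closure already cover
    [A]. For [j] at least their lengths, the [j]-th neighbourhood of [A] lies in their union. *)
Lemma in_E_nbhd A : in_E A -> forall eps, 0 < eps -> exists j, lam (nbhd A j) <= eps.
Proof.
  intros nA eps pos.
  destruct (pow_lt_1_zero (/ 2)) with (y := eps) as [n Hn];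
    [rewrite Rabs_right; lra | lra |].
  destruct (nA n) as [f [sumf covf]].
  assert (fin : exists M, forall x, A x -> exists i, (i < M)%nat /\ in_cyl (f i) x 0).
  { apply NNPP. intro nfin.
    (* Here [x] is bad at level [k] when no finite part of the cover contains all points of [A] that
       agree with [x] below [k]. *)
    destruct (bad_branch (fun k x => forall M, exists y, A y /\
      (forall i, (i < k)%nat -> y i = x i) /\ forall i, (i < M)%nat -> ~ in_cyl (f i) y 0))
      as [x bx].
    - intros k x y e h M. destruct (h M) as (z & Az & zx & nz). exists z.
      repeat split; auto. intros i l. rewrite zx, e; auto.
    - intros x M. apply NNPP. intro no. apply nfin. exists M. intros y Ay.
      apply NNPP. intro nex. apply no. exists y. repeat split; auto; [intros i l; lia |].
      intros i l c. apply nex. eauto.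
    - intros k x h. apply NNPP. intro no.
      assert (good : forall b, exists M, forall y, A y -> (forall i, (i < k)%nat -> y i = x i) ->
                 y k = b -> exists i, (i < M)%nat /\ in_cyl (f i) y 0).
      { intro b. apply NNPP. intro nb. apply no.
        exists (fun i => if Nat.eq_dec i k then b else x i). split.
        - intros i l. destruct Nat.eq_dec; [lia | reflexivity].
        - intro M. apply NNPP. intro nM. apply nb. exists M. intros y Ay yx yk.
          apply NNPP. intro nex. apply nM. exists y. repeat split; auto.
          + intros i l. destruct Nat.eq_dec as [-> |]; [exact yk | apply yx; lia].
          + intros i l c. apply nex. eauto. }
      destruct (good true) as [M HM], (good false) as [M' HM'].
      destruct (h (Nat.max M M')) as (y & Ay & yx & ny).
      destruct (y k) eqn:yk;
      [destruct (HM y Ay yx yk) as (i & l & c) | destruct (HM' y Ay yx yk) as (i & l & c)];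
      apply (ny i); auto; lia.
    (* The branch lies in the closure, hence in some cylinder [f i]; this contradicts its badness at
       level [length (f i)] for the first [S i] cylinders. *)
    - assert (cx : closure2 A x).
      { intro k. destruct (bx k O) as (y & Ay & yx & _). eauto. }
      destruct (covf x cx) as [i ci].
      destruct (bx (length (f i)) (S i)) as (y & Ay & yx & ny).
      apply (ny i); [lia |]. apply (in_cyl_agree (f i) x); [| exact ci].
      intros m l. symmetry. apply yx, l. }
  destruct fin as [M HM].
  assert (maxlen : exists j, forall i, (i < M)%nat -> (length (f i) <= j)%nat).
  { clear. induction M as [| M [j Hj]]; [exists O; intros; lia |].
    exists (Nat.max j (length (f M))). intros i l.
    destruct (Nat.eq_dec i M) as [-> |]; [lia |]. specialize (Hj i). lia. }
  destruct maxlen as [j Hj]. exists j.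
  rewrite (lam_dep j) by apply nbhd_dep.
  apply Rle_trans with (avg j (fun x => exists i, (i < M)%nat /\ in_cyl (f i) x 0)).
  { apply avg_mono. intros x (y & Ay & yx). destruct (HM y Ay) as (i & l & c).
    exists i. split; [exact l |]. apply (in_cyl_agree (f i) y); [| exact c].
    intros m lm. apply yx. specialize (Hj i l). lia. }
  apply Rle_trans with (cyl_sum f M).
  - clear HM. induction M as [| M IH]; simpl.
    + rewrite avg_empty; [lra |]. intros x (i & l & _). lia.
    + apply Rle_trans with (avg j (fun x => (exists i, (i < M)%nat /\ in_cyl (f i) x 0)
                                            \/ in_cyl (f M) x 0)).
      * apply avg_mono. intros x (i & l & c).
        destruct (Nat.eq_dec i M) as [-> | ne]; [auto | left; exists i; split; [lia | exact c]].
      * assert (e := avg_or_and j (fun x => exists i, (i < M)%nat /\ in_cyl (f i) x 0)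
                       (fun x => in_cyl (f M) x 0)).
        match type of e with _ + ?a = _ => assert (0 <= a) by apply avg_ge0 end.
        assert (avg j (fun x => in_cyl (f M) x 0) <= (/ 2) ^ length (f M))
          by (apply avg_in_cyl, Hj; lia).
        assert (avg j (fun x => exists i, (i < M)%nat /\ in_cyl (f i) x 0) <= cyl_sum f M)
          by (apply IH; intros i l; apply Hj; lia).
        lra.
  - eapply Rle_trans; [apply sumf |].
    specialize (Hn n (le_n n)). apply Rabs_def2 in Hn. lra.
Qed.

(** * Sequences of clopen sets avoiding countably many closed null sets *)

Lemma not_finite_above (X : nat -> Prop) :
  ~ finite_set X -> forall m, exists n, (m <= n)%nat /\ X n.
Proof.
  intros nf m. apply NNPP. intro no. apply nf. exists m. intros k Xk.
  apply Nat.nle_gt. intro l. apply no. eauto.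
Qed.

Fixpoint list_code (s : list nat) : nat :=
  match s with
  | nil => O
  | a :: l => S (Cantor.to_nat (a, list_code l))
  end.

Lemma list_code_inj s : forall s', list_code s = list_code s' -> s = s'.
Proof.
  induction s as [| a s IH]; intros [| a' s'] e; try discriminate; [reflexivity |].
  apply Nat.succ_inj, Cantor.to_nat_inj in e. injection e as -> e. f_equal. auto.
Qed.

(** The radius needed at a step depends on the radii chosen before, so a requirement is a function
    of finite sequences; the coding turns it into a function on [nat] that can be dominated. *)
Lemma small_list_code {T : Type} (S : T -> Prop) (h : T -> list nat -> nat) :
  small S -> exists f : list nat -> nat, forall t, S t ->
    exists N, forall s, (N <= list_code s)%nat -> (h t s <= f s)%nat.
Proof.
  intro sS.
  set (decode := fun m => epsilon (inhabits nil) (fun s => list_code s = m)).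
  assert (dc : forall s, decode (list_code s) = s).
  { intro s. apply list_code_inj. apply (epsilon_spec (inhabits nil) (fun s' => list_code s' = _)).
    eauto. }
  destruct (sS (fun t m => h t (decode m))) as [g Hg].
  exists (fun s => g (list_code s)). intros t St. destruct (Hg t St) as [N HN].
  exists N. intros s l. specialize (HN _ l). rewrite dc in HN. exact HN.
Qed.

Section AvoidingSequence.

Variable A : nat -> (nat -> bool) -> Prop.
Hypothesis nullA : forall i eps, 0 < eps -> exists j, lam (nbhd (A i) j) <= eps.

(* [remaining s] removes from the space the neighbourhood of [A i] of radius [s_i], where [s_i]
   is the [i]-th entry of [s] counted from the end of the list. *)
Fixpoint remaining (s : list nat) : (nat -> bool) -> Prop :=
  match s with
  | nil => fun _ => True
  | j :: l => fun x => remaining l x /\ ~ nbhd (A (length l)) j x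
  end.

Lemma clopen_nbhd i j : clopen (nbhd (A i) j).
Proof. exists j. apply nbhd_dep. Qed.

Lemma clopen_remaining s : clopen (remaining s).
Proof.
  induction s as [| j l IH]; simpl; [apply clopen_const |].
  apply clopen_and, clopen_not, clopen_nbhd. exact IH.
Qed.

Definition weight (p : nat -> (nat -> bool) -> Prop) (P : (nat -> bool) -> Prop) : R :=
  lim_lam (fun m x => p m x /\ P x).

Lemma cauchy_weight p P : cauchy_clopen p -> clopen P -> cauchy_clopen (fun m x => p m x /\ P x).
Proof. intros cp cP. apply cauchy_and, cauchy_const; assumption. Qed.

Lemma weight_ge0 p P : cauchy_clopen p -> clopen P -> 0 <= weight p P.
Proof. intros cp cP. apply lim_lam_ge0, cauchy_weight; assumption. Qed.

Lemma weight_mono p P Q : cauchy_clopen p -> clopen P -> clopen Q ->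
  (forall x, P x -> Q x) -> weight p P <= weight p Q.
Proof.
  intros cp cP cQ PQ. apply lim_lam_mono; try (apply cauchy_weight; assumption).
  exists O. intros m x _ [a b]. auto.
Qed.

Lemma weight_le_lam p P : cauchy_clopen p -> clopen P -> weight p P <= lam P.
Proof.
  intros cp cP. rewrite <- lim_lam_const.
  apply lim_lam_mono; [apply cauchy_weight; assumption | apply cauchy_const, cP |].
  exists O. tauto.
Qed.

Lemma weight_split p P Q : cauchy_clopen p -> clopen P -> clopen Q ->
  weight p (fun x => P x /\ Q x) + weight p (fun x => P x /\ ~ Q x) = weight p P.
Proof.
  intros cp cP cQ. unfold weight.
  rewrite <- (lim_lam_split (fun m x => p m x /\ P x) (fun _ => Q))
    by (apply cauchy_weight || apply cauchy_const; assumption).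
  f_equal; apply lim_lam_ext; intros; tauto.
Qed.

(** The allowed losses, as fractions of the current weight, sum to at most one half over all steps.
    If all steps from some point on are slow, at least half of the weight at that point survives. *)
Definition slow_at (p : nat -> (nat -> bool) -> Prop) (s : list nat) (j : nat) : Prop :=
  0 < weight p (remaining s) ->
  weight p (fun x => remaining s x /\ nbhd (A (length s)) j x)
  <= (/ 2) ^ (length s + 2) * weight p (remaining s).

Lemma slow_at_exists p s : cauchy_clopen p -> exists j, slow_at p s j.
Proof.
  intro cp. destruct (classic (0 < weight p (remaining s))) as [pos | n]; [| exists O; red; tauto].
  destruct (nullA (length s) ((/ 2) ^ (length s + 2) * weight p (remaining s))) as [j Hj].
  { apply Rmult_lt_0_compat; [apply pow_lt; lra | exact pos]. }
  exists j. intros _. eapply Rle_trans; [| exact Hj].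
  eapply Rle_trans; [| apply weight_le_lam; [exact cp | apply clopen_nbhd]].
  apply weight_mono; try apply clopen_and; auto using clopen_nbhd, clopen_remaining.
  tauto.
Qed.

Lemma slow_at_mono p s j k : cauchy_clopen p -> (j <= k)%nat -> slow_at p s j -> slow_at p s k.
Proof.
  intros cp l h pos. eapply Rle_trans; [| apply h, pos].
  apply weight_mono; try apply clopen_and; auto using clopen_nbhd, clopen_remaining.
  intros x [a b]. split; [exact a | apply (nbhd_anti _ j k); auto].
Qed.

Lemma slow_at_weight p s j : cauchy_clopen p -> slow_at p s j -> 0 < weight p (remaining s) ->
  (1 - (/ 2) ^ (length s + 2)) * weight p (remaining s) <= weight p (remaining (j :: s)).
Proof.
  intros cp h pos. specialize (h pos).
  assert (e := weight_split p (remaining s) (nbhd (A (length s)) j) cp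
                 (clopen_remaining s) (clopen_nbhd _ _)).
  simpl. lra.
Qed.

(** A single [f] dominates, for almost all [s], the radius that each [t] in [S] requires after [s].
    With radii the maximum of [h0] and [f], every step is slow for the whole space, and all but
    finitely many are slow for a given [t]; at most half of the weight left at that moment is lost
    later. *)
Lemma avoiding_sequence {T : Type} (S : T -> Prop) (p : T -> nat -> (nat -> bool) -> Prop) :
  small S -> (forall t, S t -> cauchy_clopen (p t)) ->
  exists C : nat -> (nat -> bool) -> Prop, (forall k, clopen (C k)) /\ decreasing_sets C /\ (forall k, 0 < lam (C k)) /\
    (forall i x, A i x -> exists k, ~ C k x) /\
    (forall t, S t -> (forall k, 0 < weight (p t) (C k)) ->
       exists eps, 0 < eps /\ forall k, eps <= weight (p t) (C k)).
Proof.
  intros sS cp.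
  set (full := fun (_ : nat) (_ : nat -> bool) => True).
  assert (cfull : cauchy_clopen full) by (apply cauchy_const, clopen_const).
  destruct (choice (fun s j => slow_at full s j)) as [h0 Hh0].
  { intro s. apply slow_at_exists, cfull. }
  destruct (choice (fun (q : T * list nat) j => S (fst q) -> slow_at (p (fst q)) (snd q) j))
    as [h Hh].
  { intros [t s]. simpl. destruct (classic (S t)) as [St | n]; [| exists O; tauto].
    destruct (slow_at_exists (p t) s (cp t St)) as [j Hj]. eauto. }
  destruct (small_list_code S (fun t s => h (t, s)) sS) as [f Hf].
  set (sigma := fix sigma n := match n with
     | O => nil
     | Datatypes.S m => Nat.max (h0 (sigma m)) (f (sigma m)) :: sigma m end).
  assert (len : forall n, length (sigma n) = n).
  { induction n as [| n IH]; simpl; congruence. }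
  (* The codes along [sigma] tend to infinity, so every threshold on codes is passed. *)
  assert (code : forall n, (n <= list_code (sigma n))%nat).
  { induction n as [| n IH]; [simpl; lia |].
    assert (h1 := Cantor.to_nat_non_decreasing
                    (Nat.max (h0 (sigma n)) (f (sigma n))) (list_code (sigma n))).
    change (Datatypes.S n <= Datatypes.S (Cantor.to_nat
      (Nat.max (h0 (sigma n)) (f (sigma n)), list_code (sigma n))))%nat. lia. }
  assert (dec1 : forall n x, remaining (sigma (Datatypes.S n)) x -> remaining (sigma n) x).
  { intros n x. simpl. tauto. }
  assert (dec : decreasing_sets (fun n => remaining (sigma n))).
  { intros k l x kl. induction kl as [| l kl IH]; auto. }
  assert (small_pow : forall n, 0 < (/ 2) ^ (n + 1) <= / 2).
  { induction n as [| n [IH1 IH2]]; simpl in *; lra. }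
  exists (fun n => remaining (sigma n)). repeat split.
  - intro k. apply clopen_remaining.
  - exact dec.
  - intro k.
    assert (e : forall P, lam P = weight full P).
    { intro P. rewrite <- lim_lam_const. apply lim_lam_ext. intros m x. unfold full. tauto. }
    rewrite e. induction k as [| k IH].
    + simpl. rewrite <- e, lam_full. lra.
    + eapply Rlt_le_trans; [| apply (slow_at_weight full (sigma k))].
      * apply Rmult_lt_0_compat; [| exact IH]. specialize (small_pow (length (sigma k) + 1)%nat).
        replace (length (sigma k) + 2)%nat with (length (sigma k) + 1 + 1)%nat by lia. lra.
      * exact cfull.
      * apply slow_at_mono with (j := h0 (sigma k)); auto. apply Nat.le_max_l.
      * exact IH.
  - intros i x Ai. exists (Datatypes.S i). simpl. intros [_ n]. apply n.
    rewrite len. exists x. auto.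
  - intros t St pos. destruct (Hf t St) as [N HN].
    exists (weight (p t) (remaining (sigma N)) / 2). split; [specialize (pos N); lra |].
    (* With [u = (/ 2) ^ (n + 1)] the induction step is [(1 - u / 2) * (/ 2 + u) >= / 2 + u / 2],
       valid for [0 <= u <= / 2]; the surplus over one half pays for the later losses. *)
    assert (low : forall n, (N <= n)%nat ->
      weight (p t) (remaining (sigma N)) * (/ 2 + (/ 2) ^ (n + 1))
      <= weight (p t) (remaining (sigma n))).
    { intros n l. induction l as [| n l IH].
      - specialize (pos N). specialize (small_pow N).
        rewrite <- (Rmult_1_r (weight _ _)) at 2. apply Rmult_le_compat_l; lra.
      - assert (st : slow_at (p t) (sigma n) (Nat.max (h0 (sigma n)) (f (sigma n)))).
        { apply slow_at_mono with (j := h (t, sigma n)); auto.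
          - assert (h (t, sigma n) <= f (sigma n))%nat; [| lia].
            apply HN. specialize (code n). lia.
          - apply (Hh (t, sigma n)), St. }
        assert (w := slow_at_weight _ _ _ (cp t St) st (pos n)).
        eapply Rle_trans; [| exact w]. rewrite len.
        replace (n + 2)%nat with (Datatypes.S (n + 1)) by lia.
        replace (Datatypes.S n + 1)%nat with (Datatypes.S (n + 1)) by lia. simpl pow.
        assert (sp := small_pow n). set (u := (/ 2) ^ (n + 1)) in *.
        apply Rle_trans with ((1 - / 2 * u) * (weight (p t) (remaining (sigma N)) * (/ 2 + u))).
        + specialize (pos N). set (w0 := weight (p t) (remaining (sigma N))) in *.
          replace ((1 - / 2 * u) * (w0 * (/ 2 + u))) with (w0 * ((1 - / 2 * u) * (/ 2 + u))) by ring.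
          apply Rmult_le_compat_l; [lra | nra].
        + apply Rmult_le_compat_l; [lra | exact IH]. }
    intro k. set (n := Nat.max N k).
    apply Rle_trans with (weight (p t) (remaining (sigma n))).
    + eapply Rle_trans; [| apply low; lia].
      specialize (pos N). specialize (small_pow n). unfold Rdiv.
      apply Rmult_le_compat_l; lra.
    + apply weight_mono; auto using clopen_remaining. intro x. apply dec. lia.
Qed.

End AvoidingSequence.

(** * Separating sets *)

Lemma finite_bounded (P : nat -> nat -> Prop) m :
  (forall k, finite_set (P k)) -> finite_set (fun n => exists k, (k < m)%nat /\ P k n).
Proof.
  intro h. induction m as [| m [N HN]].
  - exists O. intros k (j & l & _). lia.
  - destruct (h m) as [M HM]. exists (Nat.max N M). intros n (k & l & q).
    destruct (Nat.eq_dec k m) as [-> | ne]; [specialize (HM n q); lia |].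
    assert (n < N)%nat; [| lia]. apply HN. exists k. split; [lia | exact q].
Qed.

Lemma finite_subset (X Y : nat -> Prop) : (forall n, X n -> Y n) -> finite_set Y -> finite_set X.
Proof. intros s [N HN]. exists N. auto. Qed.

Lemma finite_union (X Y : nat -> Prop) :
  finite_set X -> finite_set Y -> finite_set (fun n => X n \/ Y n).
Proof.
  intros [N HN] [M HM]. exists (Nat.max N M). intros k [x | y];
  [specialize (HN k x) | specialize (HM k y)]; lia.
Qed.

(** The set [Z] agrees with [C k] on the interval from [g k] to [g (S k)]. For almost all [k], the
    function [f] bounds both a point beyond [k] of [E t] in [C k], if [E t] meets [C k] in an
    infinite set, and the part of [E t] outside [C k], if that is finite. *)
Lemma separating_set {T : Type} (S : T -> Prop) (E : T -> nat -> Prop) (C : nat -> nat -> Prop) :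
  small S -> (forall k l n, (k <= l)%nat -> C l n -> C k n) ->
  exists Z : nat -> Prop,
    (forall k, finite_set (fun n => Z n /\ ~ C k n)) /\
    (forall t, S t -> (forall k, ~ finite_set (fun n => E t n /\ C k n)) ->
       ~ finite_set (fun n => E t n /\ Z n)) /\
    (forall t, S t -> (forall k, finite_set (fun n => E t n /\ ~ C k n)) ->
       finite_set (fun n => E t n /\ ~ Z n)).
Proof.
  intros sS dec.
  destruct (choice (fun (q : T * nat) n =>
     ~ finite_set (fun n => E (fst q) n /\ C (snd q) n) ->
     (snd q <= n)%nat /\ E (fst q) n /\ C (snd q) n)) as [h1 Hh1].
  { intros [t k]. simpl. destruct (classic (finite_set (fun n => E t n /\ C k n))) as [y | nf].
    - exists O. tauto.
    - destruct (not_finite_above _ nf k) as [n Hn]. exists n. tauto. }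
  destruct (choice (fun (q : T * nat) N =>
     finite_set (fun n => E (fst q) n /\ ~ C (snd q) n) ->
     forall n, E (fst q) n /\ ~ C (snd q) n -> (n < N)%nat)) as [h2 Hh2].
  { intros [t k]. simpl. destruct (classic (finite_set (fun n => E t n /\ ~ C k n))) as [[N HN] | nf].
    - exists N. auto.
    - exists O. tauto. }
  destruct (sS (fun t k => Nat.max (h1 (t, k)) (h2 (t, k)))) as [f Hf].
  (* For large [k], [f k <= g k] keeps a finite part of [E t] outside [C k] below [g k], while
     [f (g k) < g (S k)] puts a point of [E t] in [C (g k)] between [g k] and [g (S k)]. *)
  set (g := fix g k := match k with
     | O => f O
     | Datatypes.S m => Datatypes.S (g m + Nat.max (f (g m)) (f k)) end).
  assert (gS : forall k, g (Datatypes.S k) =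
     Datatypes.S (g k + Nat.max (f (g k)) (f (Datatypes.S k)))) by reflexivity.
  assert (gf : forall k, (f k <= g k)%nat).
  { intros [| k]; [simpl; lia | rewrite gS; lia]. }
  assert (gmono : forall k l, (k < l)%nat -> (g k < g l)%nat).
  { intros k l kl. induction kl as [| l kl IH]; rewrite gS; lia. }
  assert (gid : forall k, (k <= g k)%nat).
  { induction k as [| k IH]; [lia | rewrite gS; lia]. }
  exists (fun n => forall k, (g k <= n)%nat -> C k n). split; [| split].
  - intro k. exists (g k). intros n [z nc]. apply Nat.nle_gt. intro l. apply nc, z, l.
  - intros t St inf [M HM]. destruct (Hf t St) as [N HN].
    set (k := Nat.max N M). assert (gk := gid k).
    destruct (Hh1 (t, g k) (inf (g k))) as (l1 & e & c). simpl in l1, e, c.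
    assert (b : (h1 (t, g k) <= f (g k))%nat) by (specialize (HN (g k)); lia).
    assert (h1 (t, g k) < M)%nat; [| lia].
    apply HM. split; [exact e |]. intros j lj. apply (dec j (g k)); [| exact c].
    apply Nat.le_trans with k; [| exact gk]. apply Nat.nlt_ge. intro kj.
    assert (g (Datatypes.S k) <= g j)%nat.
    { destruct (Nat.eq_dec (Datatypes.S k) j) as [-> | ne]; [lia |].
      apply Nat.lt_le_incl, gmono. lia. }
    rewrite gS in H. lia.
  - intros t St fin. destruct (Hf t St) as [N HN].
    apply finite_subset with (Y := fun n => exists k, (k < N)%nat /\ E t n /\ ~ C k n).
    + intros n [e nz]. apply not_all_ex_not in nz. destruct nz as [k nz].
      apply imply_to_and in nz. destruct nz as [l nc]. exists k. split; [| tauto].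
      apply Nat.nle_gt. intro Nk.
      assert (n < h2 (t, k))%nat by (apply (Hh2 (t, k)); simpl; auto).
      specialize (HN k Nk). specialize (gf k). lia.
    + apply (finite_bounded (fun k n => E t n /\ ~ C k n)), fin.
Qed.

(** * Boolean terms *)

Inductive term (G : Type) : Type :=
  | Bit (i : nat)
  | Gen (g : G)
  | Compl (t : term G)
  | Meet (t s : term G).

Arguments Bit {G} i.
Arguments Gen {G} g.
Arguments Compl {G} t.
Arguments Meet {G} t s.

Fixpoint gens_in {G : Type} (S : G -> Prop) (t : term G) : Prop :=
  match t with
  | Bit _ => True
  | Gen g => S g
  | Compl t => gens_in S t
  | Meet t s => gens_in S t /\ gens_in S s
  end.

Fixpoint sem {G X : Type} (bit : nat -> X -> Prop) (gen : G -> X -> Prop) (t : term G) (x : X)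
    : Prop :=
  match t with
  | Bit i => bit i x
  | Gen g => gen g x
  | Compl t => ~ sem bit gen t x
  | Meet t s => sem bit gen t x /\ sem bit gen s x
  end.

Definition Top {G : Type} : term G := Compl (Meet (Bit 0) (Compl (Bit 0))).

Lemma sem_Top {G X : Type} bit gen (x : X) : sem bit gen (@Top G) x.
Proof. simpl. tauto. Qed.

Lemma gens_in_mono {G : Type} (S S' : G -> Prop) t :
  (forall g, S g -> S' g) -> gens_in S t -> gens_in S' t.
Proof. intro h. induction t; simpl; intuition. Qed.

Lemma sem_ext {G X : Type} (S : G -> Prop) bit (gen gen' : G -> X -> Prop) t :
  (forall g, S g -> gen g = gen' g) -> gens_in S t -> sem bit gen t = sem bit gen' t.
Proof.
  intro h. induction t as [i | g | t IH | t IHt s IHs]; simpl; intro gi; extensionality x.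
  - reflexivity.
  - rewrite h by exact gi. reflexivity.
  - rewrite IH by exact gi. reflexivity.
  - rewrite IHt, IHs by tauto. reflexivity.
Qed.

(** Stratify by depth: [D] starts from images of small sets and grows by images, a product and
    unions, all of which preserve smallness. *)
Lemma small_terms {G : Type} (S : G -> Prop) : small S -> small (gens_in S).
Proof.
  intro sS.
  set (D := fix D n : term G -> Prop := match n with
     | O => fun t => (exists i, True /\ t = Bit i) \/ (exists g, S g /\ t = Gen g)
     | Datatypes.S m => fun t => D m t \/ (exists s, D m s /\ t = Compl s) \/
         (exists q, (D m (fst q) /\ D m (snd q)) /\ t = Meet (fst q) (snd q)) end).
  apply small_subset with (S' := fun t => exists n, D n t).
  - assert (mono : forall n m t, (n <= m)%nat -> D n t -> D m t).
    { intros n m t l. induction l as [| m l IH]; [auto | simpl; auto]. }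
    induction t as [i | g | t IH | t IHt s IHs]; intro gi; simpl in gi.
    + exists O. simpl. eauto.
    + exists O. simpl. eauto.
    + destruct (IH gi) as [n Hn]. exists (Datatypes.S n). simpl. eauto.
    + destruct gi as [gt gs]. destruct (IHt gt) as [n Hn], (IHs gs) as [m Hm].
      exists (Datatypes.S (Nat.max n m)). right. right. exists (t, s). simpl.
      repeat split; [apply (mono n) | apply (mono m)]; auto; lia.
  - apply small_union_nat. induction i as [| n IH]; simpl.
    + apply small_union; apply small_image; [apply small_nat | exact sS].
    + apply small_union; [exact IH |]. apply small_union.
      * apply small_image, IH.
      * apply (small_image (fun q => D n (fst q) /\ D n (snd q)) (fun q => Meet (fst q) (snd q))).
        apply small_prod; exact IH.
Qed.

(** Expand along the last coordinate that [P] may depend on. The term is uniform in the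
    interpretation: it defines [P] in the Cantor space and its periodic copy in [nat]. *)
Lemma clopen_term {G : Type} P : clopen P ->
  exists t : term G, gens_in (fun _ => False) t /\
    forall (X : Type) (bit : nat -> X -> Prop) gen x y,
      (forall i, bit i x <-> y i = true) -> (sem bit gen t x <-> P y).
Proof.
  intros [k d]. revert P d. induction k as [| k IH]; intros P d.
  - destruct (classic (P (fun _ => false))) as [p | n].
    + exists Top. split; [simpl; tauto |]. intros X bit gen x y _.
      split; [| intros; apply sem_Top]. intros _. apply (d (fun _ => false)); [lia | exact p].
    + exists (Compl Top). split; [simpl; tauto |]. intros X bit gen x y _. split.
      * intro c. simpl in c. tauto.
      * intro p. elim n. apply (d y); [lia | exact p].
  - set (upd := fun (b : bool) (x : nat -> bool) i => if Nat.eq_dec i k then b else x i).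
    assert (du : forall b, dep k (fun x => P (upd b x))).
    { intros b x y e. apply d. intros i l. unfold upd. destruct Nat.eq_dec; [reflexivity |].
      apply e. lia. }
    destruct (IH _ (du true)) as (t1 & g1 & h1), (IH _ (du false)) as (t0 & g0 & h0).
    exists (Compl (Meet (Compl (Meet (Bit k) t1)) (Compl (Meet (Compl (Bit k)) t0)))).
    split; [simpl; tauto |]. intros X bit gen x y e. simpl.
    rewrite (h1 X bit gen x y e), (h0 X bit gen x y e), (e k).
    assert (u : upd (y k) y = y).
    { extensionality i. unfold upd. destruct Nat.eq_dec as [-> |]; reflexivity. }
    destruct (y k); rewrite u.
    + assert (true = true) by reflexivity. tauto.
    + assert (false <> true) by discriminate. tauto.
Qed.

(** Meant for the largest generator [b] of [t]: the cofactors involve earlier generators only, and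
    one expansion serves both [approx] and [trace]. *)
Lemma shannon_expansion {G : Type} (S : G -> Prop) (b : G) (t : term G) :
  gens_in (fun g => S g \/ g = b) t ->
  exists t1 t0, gens_in S t1 /\ gens_in S t0 /\
    forall (X : Type) bit gen (x : X),
      sem bit gen t x <-> (sem bit gen t1 x /\ gen b x) \/ (sem bit gen t0 x /\ ~ gen b x).
Proof.
  induction t as [i | g | t IH | t IHt s IHs]; simpl; intro gi.
  - exists (Bit i), (Bit i). simpl. repeat split; tauto.
  - destruct (classic (g = b)) as [-> | ne].
    + exists Top, (Compl Top). simpl. repeat split; tauto.
    + exists (Gen g), (Gen g). simpl. repeat split; tauto.
  - destruct (IH gi) as (t1 & t0 & g1 & g0 & h). exists (Compl t1), (Compl t0).
    split; [exact g1 | split; [exact g0 |]]. intros. rewrite h. simpl. tauto.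
  - destruct (IHt (proj1 gi)) as (t1 & t0 & g1 & g0 & h).
    destruct (IHs (proj2 gi)) as (s1 & s0 & k1 & k0 & h').
    exists (Meet t1 s1), (Meet t0 s0). simpl. split; [tauto | split; [tauto |]].
    intros. rewrite h, h'. tauto.
Qed.

Lemma max_generator {G : Type} (lt : G -> G -> Prop) (S : G -> Prop) (t : term G) :
  (forall x y z, lt x y -> lt y z -> lt x z) -> (forall x y, lt x y \/ x = y \/ lt y x) ->
  gens_in S t ->
  gens_in (fun _ => False) t \/ exists b, S b /\ gens_in (fun g => lt g b \/ g = b) t.
Proof.
  intros trans tot. induction t as [i | g | t IH | t IHt s IHs]; simpl; intro gi.
  - auto.
  - eauto.
  - auto.
  - destruct (IHt (proj1 gi)) as [n | (b & Sb & h)], (IHs (proj2 gi)) as [n' | (b' & Sb' & h')].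
    + auto.
    + right. exists b'. repeat split; auto. eapply gens_in_mono; [| exact n]. tauto.
    + right. exists b. repeat split; auto. eapply gens_in_mono; [| exact n']. tauto.
    + right. destruct (tot b b') as [l | [-> | l]].
      * exists b'. repeat split; auto. eapply gens_in_mono; [| exact h].
        intros g [lg | ->]; eauto.
      * eauto.
      * exists b. repeat split; auto. eapply gens_in_mono; [| exact h'].
        intros g [lg | ->]; eauto.
Qed.

(** * The inductive construction *)

(* The first component is a decreasing sequence of clopen sets with intersection [K]; the second
   is the subset of [nat] that represents [K] in the algebra. *)
Definition stage : Type := ((nat -> (nat -> bool) -> Prop) * (nat -> Prop))%type.

Definition trace {G : Type} (F : G -> stage) (t : term G) : nat -> Prop :=
  sem (fun i n => Nat.testbit n i = true) (fun g => snd (F g)) t.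

Definition approx {G : Type} (F : G -> stage) (t : term G) (k : nat) : (nat -> bool) -> Prop :=
  sem (fun i x => x i = true) (fun g => fst (F g) k) t.

Definition measure {G : Type} (F : G -> stage) (t : term G) : R := lim_lam (approx F t).

(** The stages [F g] enter only through terms over predecessors of [b], which makes this a
    specification for well-founded recursion. *)
Record stage_ok {G K : Type} (lt : G -> G -> Prop) (c : G -> K -> Prop)
    (cov : K -> (nat -> bool) -> Prop) (b : G) (F : G -> stage) (d : stage) : Prop := {
  ok_clopen : forall k, clopen (fst d k);
  ok_decreasing : decreasing_sets (fst d);
  ok_positive : forall k, 0 < lam (fst d k);
  ok_avoid : forall xi x, c b xi -> cov xi x -> exists k, ~ fst d k x;
  ok_weight : forall t, gens_in (fun g => lt g b) t ->
    (forall k, 0 < weight (approx F t) (fst d k)) ->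
    exists eps, 0 < eps /\ forall k, eps <= weight (approx F t) (fst d k);
  ok_below : forall k, finite_set (fun n => snd d n /\ ~ fst d k (Nat.testbit n));
  ok_meet : forall t, gens_in (fun g => lt g b) t ->
    (forall k, ~ finite_set (fun n => trace F t n /\ fst d k (Nat.testbit n))) ->
    ~ finite_set (fun n => trace F t n /\ snd d n);
  ok_diff : forall t, gens_in (fun g => lt g b) t ->
    (forall k, finite_set (fun n => trace F t n /\ ~ fst d k (Nat.testbit n))) ->
    finite_set (fun n => trace F t n /\ ~ snd d n) }.

Lemma approx_cauchy {G : Type} (F : G -> stage) (S : G -> Prop) t :
  (forall g, S g -> (forall k, clopen (fst (F g) k)) /\ decreasing_sets (fst (F g))) ->
  gens_in S t -> cauchy_clopen (approx F t).
Proof.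
  intro ok. induction t as [i | g | t IH | t IHt s IHs]; simpl; intro gi.
  - apply (cauchy_const (fun x => x i = true)), clopen_bit.
  - destruct (ok g gi). apply (cauchy_decreasing (fst (F g))); assumption.
  - apply (cauchy_not (approx F t)), IH, gi.
  - apply (cauchy_and (approx F t) (approx F s)); [apply IHt | apply IHs]; apply gi.
Qed.

Lemma stage_ok_ext {G K : Type} lt (c : G -> K -> Prop) cov b (F F' : G -> stage) d :
  (forall g, lt g b -> F g = F' g) -> stage_ok lt c cov b F d -> stage_ok lt c cov b F' d.
Proof.
  intros e ok.
  assert (tr : forall t, gens_in (fun g => lt g b) t -> trace F' t = trace F t).
  { intros t gi. apply sem_ext with (S := fun g => lt g b); [| exact gi].
    intros g l. rewrite e by exact l. reflexivity. }
  assert (ap : forall t, gens_in (fun g => lt g b) t -> approx F' t = approx F t).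
  { intros t gi. extensionality k. apply sem_ext with (S := fun g => lt g b); [| exact gi].
    intros g l. rewrite e by exact l. reflexivity. }
  destruct ok. constructor; auto; intros t gi.
  - rewrite ap by exact gi. auto.
  - rewrite tr by exact gi. auto.
  - rewrite tr by exact gi. auto.
Qed.

(** The terms over the predecessors of [b] form a small family, to which [avoiding_sequence] and
    [separating_set] apply. *)
Lemma stage_exists {G K : Type} lt (c : G -> K -> Prop) cov b (F : G -> stage) :
  small (fun g => lt g b) -> countable_subset (c b) -> (forall xi, in_E (cov xi)) ->
  (forall g, lt g b -> stage_ok lt c cov g F (F g)) -> exists d, stage_ok lt c cov b F d.
Proof.
  intros sm [e He] nul ok.
  set (A := fun i x => exists xi, e i = Some xi /\ cov xi x).
  assert (nullA : forall i eps, 0 < eps -> exists j, lam (nbhd (A i) j) <= eps).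
  { intros i eps pos. unfold A. destruct (e i) as [xi |].
    - destruct (in_E_nbhd _ (nul xi) eps pos) as [j Hj]. exists j.
      rewrite (lam_ext _ (nbhd (cov xi) j)); [exact Hj |].
      intro x. unfold nbhd. split; intros (y & a & h); exists y; split; auto.
      + destruct a as (xi' & q & a). congruence.
      + eauto.
    - exists O. rewrite (lam_ext _ (fun _ => False)).
      + rewrite (lam_dep 0), avg_empty; [lra | tauto | intros x y _ p; exact p].
      + intro x. split; [| tauto]. intros (y & (xi & q & _) & _). discriminate. }
  assert (ca : forall t, gens_in (fun g => lt g b) t -> cauchy_clopen (approx F t)).
  { intros t. apply approx_cauchy. intros g l. destruct (ok g l). split; assumption. }
  assert (st := small_terms _ sm).
  destruct (avoiding_sequence A nullA _ (fun t => approx F t) st ca)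
    as (C & cl & de & pos & av & we).
  destruct (separating_set _ (fun t => trace F t) (fun k n => C k (Nat.testbit n)) st)
    as (Z & z1 & z2 & z3).
  { intros k l n kl. apply de, kl. }
  exists (C, Z). constructor; auto. simpl.
  intros xi x cx cvx. destruct (He xi cx) as [i ei]. apply (av i). exists xi. auto.
Qed.

(** * Null terms are finite *)

(** Digits beyond the prefix are free, so a nonempty clopen set corresponds to an infinite set of
    integers. *)
Lemma testbit_prefix k : forall (x : nat -> bool) N,
  exists n, (N <= n)%nat /\ forall i, (i < k)%nat -> Nat.testbit n i = x i.
Proof.
  induction k as [| k IH]; intros x N; [exists N; split; [lia | intros; lia] |].
  destruct (IH (fun i => x (S i)) N) as (n & l & h).
  exists (2 * n + Nat.b2n (x O))%nat. split; [lia |].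
  intros [| i] li.
  - apply Nat.testbit_0_r.
  - rewrite Nat.testbit_succ_r. apply h. lia.
Qed.

Lemma sem_bits {G X Y : Type} bit gen bit' gen' (t : term G) (x : X) (y : Y) :
  gens_in (fun _ => False) t -> (forall i, bit i x <-> bit' i y) ->
  (sem bit gen t x <-> sem bit' gen' t y).
Proof. intros gi e. induction t; simpl in *; firstorder. Qed.

(* A centred family in the quotient concentrates at a point of the Cantor space. *)
Lemma centred_point A (D : (nat -> Prop) -> Prop) : centred_mod_fin A D ->
  exists x : nat -> bool, forall j l, Forall D l ->
    ~ finite_set (fun k => Forall (fun X => X k) l /\
                           forall i, (i < j)%nat -> Nat.testbit k i = x i).
Proof.
  intros [_ cen].
  destruct (bad_branch (fun j x => forall l, Forall D l ->
    ~ finite_set (fun k => Forall (fun X => X k) l /\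
                           forall i, (i < j)%nat -> Nat.testbit k i = x i))) as [x Hx].
  - intros n x y e h l Dl fin. apply (h l Dl). eapply finite_subset; [| exact fin].
    intros k [a b]. split; [exact a |]. intros i li. rewrite b, e; auto.
  - intros x l Dl fin. apply (cen l Dl). eapply finite_subset; [| exact fin].
    intros k a. split; [exact a | intros; lia].
  - intros n x h. apply NNPP. intro no.
    assert (no' : forall b, exists l, Forall D l /\ finite_set (fun k => Forall (fun X => X k) l /\
       (forall i, (i < n)%nat -> Nat.testbit k i = x i) /\ Nat.testbit k n = b)).
    { intro b. apply NNPP. intro nb. apply no.
      exists (fun i => if Nat.eq_dec i n then b else x i). split.
      - intros i l. destruct Nat.eq_dec; [lia | reflexivity].
      - intros l Dl fin. apply nb. exists l. split; [exact Dl |].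
        eapply finite_subset; [| exact fin]. intros k (a & q & r). split; [exact a |].
        intros i li. destruct Nat.eq_dec as [-> | ne]; [exact r | apply q; lia]. }
    (* If both extensions fail, the two lists joined contradict [h], since bit [n] of any integer
       takes one of the two values. *)
    destruct (no' true) as (l1 & D1 & f1), (no' false) as (l0 & D0 & f0).
    apply (h (l1 ++ l0)); [apply Forall_app; auto |].
    eapply finite_subset; [| exact (finite_union _ _ f1 f0)].
    intros k [a q]. apply Forall_app in a. simpl.
    destruct (Nat.testbit k n); tauto.
  - exists x. exact Hx.
Qed.

Section NullTerms.

Variables (G K : Type) (lt : G -> G -> Prop) (c : G -> K -> Prop).
Variables (cov : K -> (nat -> bool) -> Prop) (F : G -> stage).
Hypothesis wf : well_founded lt.
Hypothesis trans : forall x y z, lt x y -> lt y z -> lt x z.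
Hypothesis tot : forall x y, lt x y \/ x = y \/ lt y x.
Hypothesis ok : forall b, stage_ok lt c cov b F (F b).

Lemma cauchy_term t : cauchy_clopen (approx F t).
Proof.
  apply approx_cauchy with (S := fun _ => True).
  - intros g _. destruct (ok g). split; assumption.
  - induction t; simpl; auto.
Qed.

Lemma cauchy_stage b : cauchy_clopen (fst (F b)).
Proof. apply (cauchy_term (Gen b)). Qed.

Definition null_iff_finite (t : term G) : Prop := measure F t = 0 <-> finite_set (trace F t).

Lemma null_iff_finite_bits t : gens_in (fun _ => False) t -> null_iff_finite t.
Proof.
  intro gi. set (P := approx F t 0).
  assert (cP : clopen P) by apply (cauchy_term t).
  assert (e : measure F t = lam P).
  { rewrite <- lim_lam_const. apply lim_lam_ext. intros k x.
    apply sem_bits; [exact gi | tauto]. }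
  assert (tr : forall n, trace F t n <-> P (Nat.testbit n)).
  { intro n. apply sem_bits; [exact gi | tauto]. }
  unfold null_iff_finite. rewrite e. split.
  - intro z. exists O. intros n h. apply tr in h. elim (lam_eq0 P cP z _ h).
  - intros [N HN]. destruct cP as [k d].
    rewrite (lam_dep k) by exact d. apply avg_empty. intros x px.
    destruct (testbit_prefix k x N) as (n & l & h).
    assert (n < N)%nat; [| lia]. apply HN, tr, (d x); [| exact px].
    intros i li. symmetry. apply h, li.
Qed.

(** By [clopen_term], [P] is given by a term without generators, so the hypothesis on terms below
    [b] still covers its meet with [t]. *)
Lemma weight_null b t :
  (forall s, gens_in (fun g => lt g b) s -> null_iff_finite s) ->
  gens_in (fun g => lt g b) t -> forall P, clopen P ->
  (weight (approx F t) P = 0 <-> finite_set (fun n => trace F t n /\ P (Nat.testbit n))).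
Proof.
  intros IH gi P cP. destruct (@clopen_term G P cP) as (u & gu & hu).
  assert (h : null_iff_finite (Meet t u)).
  { apply IH. split; [exact gi |].
    apply (gens_in_mono (fun _ => False)); [intros g [] | exact gu]. }
  unfold null_iff_finite, measure in h.
  assert (e1 : lim_lam (approx F (Meet t u)) = weight (approx F t) P).
  { apply lim_lam_ext. intros m x. unfold approx at 1. simpl.
    rewrite (hu _ (fun i x => x i = true) _ x x) by (intro; tauto). tauto. }
  rewrite e1 in h. rewrite h.
  assert (e2 : forall n, trace F (Meet t u) n <-> trace F t n /\ P (Nat.testbit n)).
  { intro n. unfold trace at 1. simpl.
    rewrite (hu _ (fun i n => Nat.testbit n i = true) _ n (Nat.testbit n)) by (intro; tauto).
    tauto. }
  split; apply finite_subset; intro n; apply e2.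
Qed.

(** By [ok_weight] a null limit is already null at some stage [k], where [weight_null] yields
    finiteness, and [ok_below] passes from [fst (F b) k] to [snd (F b)]. The converse is [ok_meet]
    contraposed. *)
Lemma null_meet b t :
  (forall s, gens_in (fun g => lt g b) s -> null_iff_finite s) ->
  gens_in (fun g => lt g b) t ->
  (lim_lam (fun k x => approx F t k x /\ fst (F b) k x) = 0 <->
   finite_set (fun n => trace F t n /\ snd (F b) n)).
Proof.
  intros IH gi. destruct (ok b) as [cl de pos av we be me di]. split.
  - intro z.
    assert (ex : exists k, ~ 0 < weight (approx F t) (fst (F b) k)).
    { apply not_all_ex_not. intro all. destruct (we t gi all) as (eps & ep & h).
      assert (eps <= 0); [| lra]. rewrite <- z.
      apply lim_lam_meet_ge; auto using cauchy_term. }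
    destruct ex as [k nk].
    assert (zk : weight (approx F t) (fst (F b) k) = 0).
    { assert (h := weight_ge0 _ _ (cauchy_term t) (cl k)). lra. }
    apply (weight_null b t IH gi _ (cl k)) in zk.
    apply finite_subset with (Y := fun n => (trace F t n /\ fst (F b) k (Nat.testbit n)) \/
       (snd (F b) n /\ ~ fst (F b) k (Nat.testbit n))).
    + intro n. tauto.
    + apply finite_union; auto.
  - intro fin.
    assert (ex : exists k, finite_set (fun n => trace F t n /\ fst (F b) k (Nat.testbit n))).
    { apply NNPP. intro no. apply (me t gi); [| exact fin]. intros k fk. apply no. eauto. }
    destruct ex as [k fk]. apply (weight_null b t IH gi _ (cl k)) in fk.
    apply Rle_antisym.
    + rewrite <- fk. apply lim_lam_meet_le; auto using cauchy_term.
    + apply lim_lam_ge0, cauchy_and; [apply cauchy_term | apply cauchy_stage].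
Qed.

(** The limit is null exactly when every stage is; [ok_diff] then gives finiteness outside
    [snd (F b)], and [ok_below] the converse. *)
Lemma null_diff b t :
  (forall s, gens_in (fun g => lt g b) s -> null_iff_finite s) ->
  gens_in (fun g => lt g b) t ->
  (lim_lam (fun k x => approx F t k x /\ ~ fst (F b) k x) = 0 <->
   finite_set (fun n => trace F t n /\ ~ snd (F b) n)).
Proof.
  intros IH gi. destruct (ok b) as [cl de pos av we be me di].
  rewrite lim_lam_diff_eq0 by auto using cauchy_term.
  assert (h : forall k, lim_lam (fun m x => approx F t m x /\ ~ fst (F b) k x) = 0 <->
     finite_set (fun n => trace F t n /\ ~ fst (F b) k (Nat.testbit n))).
  { intro k. apply (weight_null b t IH gi (fun x => ~ fst (F b) k x)), clopen_not, cl. }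
  split.
  - intro z. apply (di t gi). intro k. apply h, z.
  - intros fin k. apply h.
    apply finite_subset with (Y := fun n => (trace F t n /\ ~ snd (F b) n) \/
       (snd (F b) n /\ ~ fst (F b) k (Nat.testbit n))).
    + intro n. tauto.
    + apply finite_union; auto.
Qed.

Lemma null_iff_finite_step b t :
  (forall s, gens_in (fun g => lt g b) s -> null_iff_finite s) ->
  gens_in (fun g => lt g b \/ g = b) t -> null_iff_finite t.
Proof.
  intros IH gi.
  destruct (shannon_expansion _ b t gi) as (t1 & t0 & g1 & g0 & h).
  assert (ap : forall k x, approx F t k x <->
    (approx F t1 k x /\ fst (F b) k x) \/ (approx F t0 k x /\ ~ fst (F b) k x)).
  { intros k x. apply (h _ (fun i x => x i = true) (fun g => fst (F g) k)). }
  assert (tr : forall n, trace F t n <->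
    (trace F t1 n /\ snd (F b) n) \/ (trace F t0 n /\ ~ snd (F b) n)).
  { intro n. apply (h _ (fun i n => Nat.testbit n i = true) (fun g => snd (F g))). }
  assert (sp := lim_lam_split (approx F t) (fst (F b)) (cauchy_term t) (cauchy_stage b)).
  rewrite (lim_lam_ext (fun k x => approx F t k x /\ fst (F b) k x)
    (fun k x => approx F t1 k x /\ fst (F b) k x)) in sp by (intros; rewrite ap; tauto).
  rewrite (lim_lam_ext (fun k x => approx F t k x /\ ~ fst (F b) k x)
    (fun k x => approx F t0 k x /\ ~ fst (F b) k x)) in sp by (intros; rewrite ap; tauto).
  assert (m := null_meet b t1 IH g1). assert (d := null_diff b t0 IH g0).
  assert (p1 := lim_lam_ge0 _ (cauchy_and _ _ (cauchy_term t1) (cauchy_stage b))).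
  assert (p0 := lim_lam_ge0 _ (cauchy_and _ _ (cauchy_term t0) (cauchy_not _ (cauchy_stage b)))).
  unfold null_iff_finite, measure. split.
  - intro z. eapply finite_subset; [intro n; apply tr |].
    apply finite_union; [apply m | apply d]; lra.
  - intro fin. rewrite <- sp.
    rewrite (proj2 m), (proj2 d); [lra | |]; (eapply finite_subset; [| exact fin]);
      intros n hn; apply tr; tauto.
Qed.

(** Well-founded induction on the largest generator. The order may have no last element, so terms
    below some [b] are treated first; an arbitrary term then reduces to its own largest
    generator. *)
Lemma null_iff_finite_all t : null_iff_finite t.
Proof.
  assert (below : forall b s, gens_in (fun g => lt g b) s -> null_iff_finite s).
  { intro b. induction b as [b IH] using (well_founded_ind wf). intros s gs.
    destruct (max_generator lt _ s trans tot gs) as [n | (a & la & ga)].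
    - apply null_iff_finite_bits, n.
    - apply (null_iff_finite_step a); [apply IH, la | exact ga]. }
  destruct (max_generator lt (fun _ => True) t trans tot) as [n | (a & _ & ga)].
  - induction t; simpl; auto.
  - apply null_iff_finite_bits, n.
  - apply (null_iff_finite_step a); [apply below | exact ga].
Qed.

(** Positive measure at each stage does not exclude a null limit; [ok_weight] for [Top] gives a
    uniform positive lower bound. *)
Lemma stage_infinite b : ~ finite_set (snd (F b)).
Proof.
  intro fin. apply (null_iff_finite_all (Gen b)) in fin. unfold measure in fin.
  destruct (ok b) as [cl de pos av we be me di].
  assert (e : forall P, weight (approx F Top) P = lam P).
  { intro P. rewrite <- lim_lam_const. apply lim_lam_ext. intros m x.
    split; [tauto |]. intro p. split; [apply sem_Top | exact p]. }
  destruct (we Top) as (eps & ep & h).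
  - simpl. tauto.
  - intro k. rewrite e. apply pos.
  - assert (l := lim_lam_meet_ge (approx F Top) (fst (F b)) (cauchy_term Top) cl de eps h).
    rewrite (lim_lam_ext _ (approx F (Gen b))) in l; [lra |].
    intros k x. split; [tauto |]. intro p. split; [apply sem_Top | exact p].
Qed.

(** Both differences of the terms have finite trace, hence are null; so the measure does not depend
    on the representing term. *)
Lemma measure_almost_equal t s :
  finite_set (fun n => ~ (trace F t n <-> trace F s n)) -> measure F t = measure F s.
Proof.
  intro fin.
  assert (z : forall t s, finite_set (fun n => ~ (trace F t n <-> trace F s n)) ->
    lim_lam (fun k x => approx F t k x /\ ~ approx F s k x) = 0).
  { clear t s fin. intros t s fin. apply (null_iff_finite_all (Meet t (Compl s))).
    eapply finite_subset; [| exact fin]. intro n. unfold trace. simpl. tauto. }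
  assert (z1 := z t s fin).
  assert (z2 : lim_lam (fun k x => approx F s k x /\ ~ approx F t k x) = 0).
  { apply z. eapply finite_subset; [| exact fin]. intro n. tauto. }
  assert (e1 := lim_lam_split _ _ (cauchy_term t) (cauchy_term s)).
  assert (e2 := lim_lam_split _ _ (cauchy_term s) (cauchy_term t)).
  rewrite (lim_lam_ext (fun k x => approx F s k x /\ approx F t k x)
    (fun k x => approx F t k x /\ approx F s k x)) in e2 by (intros; tauto).
  unfold measure. lra.
Qed.

(** * The algebra and its measure *)

Definition represents (t : term G) (X : nat -> Prop) : Prop :=
  finite_set (fun n => ~ (X n <-> trace F t n)).

Definition alg (X : nat -> Prop) : Prop := exists t, represents t X.

Definition alg_measure (X : nat -> Prop) : R :=
  measure F (epsilon (inhabits Top) (fun t => represents t X)).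

Lemma alg_measure_eq t X : represents t X -> alg_measure X = measure F t.
Proof.
  intro r. unfold alg_measure.
  assert (r' := epsilon_spec (inhabits Top) (fun t => represents t X) (ex_intro _ t r)).
  apply measure_almost_equal.
  eapply finite_subset; [| exact (finite_union _ _ r r')]. intro n. simpl. tauto.
Qed.

Lemma represents_or t s X Y : represents t X -> represents s Y ->
  represents (Compl (Meet (Compl t) (Compl s))) (fun n => X n \/ Y n).
Proof.
  intros rt rs. eapply finite_subset; [| exact (finite_union _ _ rt rs)].
  intro n. unfold trace. simpl. tauto.
Qed.

Lemma alg_bool_alg : bool_alg_containing_fin alg.
Proof.
  split; [| split].
  - intros X fX. exists (Compl Top). eapply finite_subset; [| exact fX].
    intro n. unfold trace. simpl. tauto.
  - intros X [t r]. exists (Compl t). eapply finite_subset; [| exact r].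
    intro n. unfold trace. simpl. tauto.
  - intros X Y [t r] [s r']. eexists. apply represents_or; eauto.
Qed.

Lemma alg_measure_prob : fa_prob_measure alg alg_measure.
Proof.
  split; [| split].
  - rewrite (alg_measure_eq Top).
    + rewrite <- lam_full, <- lim_lam_const. apply lim_lam_ext. intros k x.
      split; [tauto | intros _; apply sem_Top].
    + exists O. intros n h. elim h. split; [intros _; apply sem_Top | tauto].
  - intros X [t r]. rewrite (alg_measure_eq t X r). apply lim_lam_ge0, cauchy_term.
  - intros X Y [t r] [s r'] dis.
    rewrite (alg_measure_eq t X r), (alg_measure_eq s Y r').
    rewrite (alg_measure_eq _ _ (represents_or _ _ _ _ r r')).
    (* Disjoint [X] and [Y] have almost disjoint representatives, whose meet is finite and hence
       null. *)
    assert (z : lim_lam (fun k x => approx F t k x /\ approx F s k x) = 0).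
    { apply (null_iff_finite_all (Meet t s)).
      eapply finite_subset; [| exact (finite_union _ _ r r')].
      intro n. specialize (dis n). unfold trace. simpl. tauto. }
    assert (e := lim_lam_or _ _ (cauchy_term t) (cauchy_term s)). rewrite z in e.
    unfold measure. rewrite <- e, Rplus_0_r. apply lim_lam_ext. intros k x.
    unfold approx. simpl. tauto.
Qed.

Lemma alg_measure_almost_strictly_positive : almost_strictly_positive alg alg_measure.
Proof.
  intros X [t r]. rewrite (alg_measure_eq t X r).
  etransitivity; [apply (null_iff_finite_all t) |]. unfold represents in r.
  split; intro fin; (eapply finite_subset; [| exact (finite_union _ _ fin r)]);
    intro n; simpl; tauto.
Qed.

(** The centred families concentrate at points [x n], which lie in null sets [cov (xi n)];
    cofinality gives one [b] whose sequence avoids all of these. A family containing [snd (F b)]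
    cannot concentrate at its [x n], since some clopen [fst (F b) k] misses [x n] and almost
    contains [snd (F b)]. *)
Lemma alg_not_sigma_centred :
  (forall x, exists xi, cov xi x) ->
  (forall S : K -> Prop, countable_subset S -> exists b, forall x, S x -> c b x) ->
  ~ quotient_sigma_centred alg.
Proof.
  intros cv cof (D & cen & all).
  destruct (choice _ (fun n => centred_point _ _ (cen n))) as [x Hx].
  destruct (choice _ (fun n => cv (x n))) as [xi Hxi].
  destruct (cof (fun a => exists n, xi n = a)) as [b Hb].
  { exists (fun n => Some (xi n)). intros a [n <-]. eauto. }
  assert (ab : alg (snd (F b))).
  { exists (Gen b). exists O. intros n h. elim h. unfold trace. simpl. tauto. }
  destruct (all _ ab (stage_infinite b)) as [n Dn].
  destruct (ok_avoid _ _ _ _ _ _ (ok b) (xi n) (x n)) as [k nk]; [eauto | apply Hxi |].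
  destruct (ok_clopen _ _ _ _ _ _ (ok b) k) as [j d].
  apply (Hx n j (snd (F b) :: nil)); [constructor; auto |].
  eapply finite_subset; [| apply (ok_below _ _ _ _ _ _ (ok b) k)].
  intros m [a q]. split; [inversion a; assumption |].
  intro cm. apply nk. apply (d (Nat.testbit m)); assumption.
Qed.

End NullTerms.

Theorem theorem2p2 :
  hyp_star ->
  exists (A : (nat -> Prop) -> Prop) (mu : (nat -> Prop) -> R),
    bool_alg_containing_fin A /\ fa_prob_measure A mu /\
    ~ quotient_sigma_centred A /\ almost_strictly_positive A mu.
Proof.
  intros (K & [(cov & nul & cv) _] & star).
  destruct small_index_order as (B & lt & h & wf & trans & tot & unb & sm).
  destruct (star B h unb) as (c & cnt & cof).
  (* Any stage serves as the default value. *)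
  destruct (wf_dependent_choice B stage lt (fun _ _ => True, fun _ => True)
              (stage_ok lt c cov) wf trans) as [F ok].
  - intros b F F' d. apply stage_ok_ext.
  - intros b F. apply stage_exists; auto.
  - exists (alg B F), (alg_measure B F). split; [| split; [| split]].
    + apply alg_bool_alg.
    + eapply alg_measure_prob; eauto.
    + eapply alg_not_sigma_centred; eauto.
    + eapply alg_measure_almost_strictly_positive; eauto.
Qed.
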